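(* Let $g$ be a real function defined on the spectrum $\{\lambda_1,\ldots,\lambda_n\}$ and let $\pi\in S_n$. In $\pi$-bidiagonal coordinates on $\mathcal{U}^\pi_\Lambda$, the differential equation $T'=[T,\Pi_a g(T)]$ on $\mathcal{T}_\Lambda$ becomes the decoupled linear system $$\frac{d}{dt}\beta^\pi_i=\big(g(\lambda^\pi_{i+1})-g(\lambda^\pi_i)\big)\beta^\pi_i,\quad i=1,\ldots,n-1.$$ In particular, if $T(t)$ is a solution with $T(0)\in\mathcal{U}^\pi_\Lambda$, $\beta^\pi_k(t)$ are the $\pi$-bidiagonal coordinates of $T(t)$, and $$g(\lambda_{\pi(1)})>g(\lambda_{\pi(2)})>\cdots>g(\lambda_{\pi(n)}),$$ then $\lim_{t\to+\infty}\beta^\pi_k(t)=0$ for all $k = 1,\ldots,n-1$, so that $\lim_{t\to+\infty}T(t)=\Lambda^\pi$, with asymptotics $$\beta^\pi_k(0)=\lim_{t\to+\infty}(T(t))_{k,k+1}\exp\Big(\big(g(\lambda_{\pi(k)})-g(\lambda_{\pi(k+1)})\big)t\Big),\quad k=1,\ldots,n-1.$$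
   Context: Fix real numbers $\lambda_1 < \cdots < \lambda_n$ ($n\ge2$) and $\Lambda = \operatorname{diag}(\lambda_1,\ldots,\lambda_n)$. Let $\mathcal{T}_\Lambda$ be the set of real symmetric tridiagonal $n\times n$ matrices conjugate to $\Lambda$, a compact smooth submanifold of the space of real symmetric tridiagonal matrices. $Q^*$ denotes the transpose and $O(n)$ the real orthogonal group. A matrix $M$ is $LU$-positive if it admits a (unique) factorization $M = LU$ with $L=\mathbf{L}(M)$ lower triangular with unit diagonal and $U$ upper triangular with positive diagonal entries. For $\pi \in S_n$, let $\lambda^\pi_i=\lambda_{\pi(i)}$ and $\Lambda^\pi = \operatorname{diag}(\lambda^\pi_1,\ldots,\lambda^\pi_n)$. The chart domain $\mathcal{U}^\pi_\Lambda\subset\mathcal{T}_\Lambda$ is the open set of $T\in\mathcal{T}_\Lambda$ for which there is a (necessarily unique) $LU$-positive $Q_\pi\in O(n)$ with $T = Q_\pi^*\Lambda^\pi Q_\pi$. For such $T$ let $L_\pi=\mathbf{L}(Q_\pi)$ and $B_\pi=L_\pi^{-1}\Lambda^\pi L_\pi$; this matrix is lower bidiagonal, and the $\pi$-bidiagonal coordinates of $T$ are $\beta^\pi_i=(B_\pi)_{i+1,i}$, $i=1,\ldots,n-1$. The map $T\mapsto(\beta^\pi_1,\ldots,\beta^\pi_{n-1})$ is a diffeomorphism from $\mathcal{U}^\pi_\Lambda$ onto $\mathbb{R}^{n-1}$. $[A_1,A_2]=A_1A_2-A_2A_1$; $\Pi_a(M)$ is the skew-symmetric matrix having the same (strictly)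 lower triangular entries as $M$; $g(T)$ is defined by functional calculus. For $T\in\mathcal{T}_\Lambda$ the matrix $[T,\Pi_a g(T)]$ is symmetric and tridiagonal, and solutions of $T'=[T,\Pi_a g(T)]$ starting in $\mathcal{T}_\Lambda$ stay in $\mathcal{T}_\Lambda$ and are defined for all $t\in\mathbb{R}$. *)

(* Defs.v *)
From mathcomp Require Import all_boot all_order all_fingroup all_algebra.
From mathcomp Require Import all_classical all_reals all_analysis.

Set Implicit Arguments.
Unset Strict Implicit.
Unset Printing Implicit Defensive.

Import Order.TTheory GRing.Theory Num.Theory.
Import numFieldNormedType.Exports.

Local Open Scope classical_set_scope.
Local Open Scope ring_scope.

Lemma ord_next_subproof (n : nat) (i : 'I_n.-1) : (i.+1 < n)%N.
Proof. by case: n i => [|n] [i lt_i]. Qed.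

(* For i : 'I_n.-1, the consecutive indices i and i + 1, seen in 'I_n. *)
Definition ord_this (n : nat) (i : 'I_n.-1) : 'I_n := widen_ord (leq_pred n) i.
Definition ord_next (n : nat) (i : 'I_n.-1) : 'I_n :=
  Ordinal (ord_next_subproof i).

Definition tridiagonal (R : realType) (n : nat) (T : 'M[R]_n) : Prop :=
  forall i j : 'I_n, ((i.+1 < j) || (j.+1 < i))%N -> T i j = 0.

Definition orthogonal_mx (R : realType) (n : nat) (Q : 'M[R]_n) : Prop :=
  Q^T *m Q = 1%:M.

(* MathComp's [is_trig_mx] means lower triangular. *)
Definition LU_factors (R : realType) (n : nat) (M L U : 'M[R]_n) : Prop :=
  [/\ is_trig_mx L, forall i, L i i = 1,
      is_trig_mx U^T, forall i, 0 < U i i & M = L *m U].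

Definition LU_positive (R : realType) (n : nat) (M : 'M[R]_n) : Prop :=
  exists L U, LU_factors M L U.

(* The factor L is unique when M is LU-positive; otherwise the value is junk. *)
Definition L_factor (R : realType) (n : nat) (M : 'M[R]_n) : 'M[R]_n :=
  xget 1%:M [set L | exists U, LU_factors M L U].

(* Lambda^pi; Lambda itself is the case pi = 1. *)
Definition diag_perm (R : realType) (n : nat) (lam : 'I_n -> R) (pi : 'S_n) :
    'M[R]_n :=
  diag_mx (\row_i lam (pi i)).

Definition isospectral (R : realType) (n : nat) (lam : 'I_n -> R) :
    set 'M[R]_n :=
  [set T | [/\ T^T = T, tridiagonal T
             & similar_in unitmx T (diag_mx (\row_i lam i))]].

Definition chart_frame (R : realType) (n : nat) (lam : 'I_n -> R) (pi : 'S_n)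
    (T Q : 'M[R]_n) : Prop :=
  [/\ orthogonal_mx Q, LU_positive Q & T = Q^T *m diag_perm lam pi *m Q].

Definition chart_domain (R : realType) (n : nat) (lam : 'I_n -> R)
    (pi : 'S_n) : set 'M[R]_n :=
  [set T | isospectral lam T /\ exists Q, chart_frame lam pi T Q].

(* For T in the chart domain, Q_pi is unique; the functions below are
   meaningful only there. *)
Definition chart_Q (R : realType) (n : nat) (lam : 'I_n -> R) (pi : 'S_n)
    (T : 'M[R]_n) : 'M[R]_n :=
  xget 1%:M [set Q | chart_frame lam pi T Q].

Definition chart_B (R : realType) (n : nat) (lam : 'I_n -> R) (pi : 'S_n)
    (T : 'M[R]_n) : 'M[R]_n :=
  let L := L_factor (chart_Q lam pi T) in
  invmx L *m diag_perm lam pi *m L.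

Definition bidiag_coord (R : realType) (n : nat) (lam : 'I_n -> R) (pi : 'S_n)
    (T : 'M[R]_n) (i : 'I_n.-1) : R :=
  chart_B lam pi T (ord_next i) (ord_this i).

(* g(T) = Q^* g(D) Q for any orthogonal diagonalization T = Q^* D Q: the
   result does not depend on (Q, D), and only the values of g on the spectrum
   of T matter. *)
Definition fun_calculus (R : realType) (n : nat) (g : R -> R) (T : 'M[R]_n) :
    'M[R]_n :=
  xget 0 [set G | exists (Q : 'M[R]_n) (d : 'rV[R]_n),
    [/\ orthogonal_mx Q, T = Q^T *m diag_mx d *m Q
      & G = Q^T *m diag_mx (map_mx g d) *m Q]].

Definition mx_bracket (R : realType) (n : nat) (A B : 'M[R]_n) : 'M[R]_n :=
  A *m B - B *m A.

Definition skew_part (R : realType) (n : nat) (M : 'M[R]_n) : 'M[R]_n :=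
  \matrix_(i, j) (if (j < i)%N then M i j
                  else if (i < j)%N then - M j i else 0).

Definition toda_field (R : realType) (n : nat) (g : R -> R) (T : 'M[R]_n) :
    'M[R]_n :=
  mx_bracket T (skew_part (fun_calculus g T)).

(* Solutions on J of the differential equation on the isospectral manifold. *)
Definition toda_solution (R : realType) (n : nat) (lam : 'I_n -> R)
    (g : R -> R) (J : set R) (T : R -> 'M[R]_n) : Prop :=
  forall t, J t -> isospectral lam (T t) /\ is_derive t 1 T (toda_field g (T t)).

(* Main.v *)
Require Import Defs.
From mathcomp Require Import all_boot all_order all_fingroup all_algebra.
From mathcomp Require Import all_classical all_reals all_analysis.
From mathcomp Require Import ring lra.

(** Write [Lambda] for [Lambda^pi], [G = g(Lambda)], and let [Q0 = L0 U0] be the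
    LU-positive frame of a point [T0 = Q0^T Lambda Q0] of the chart.

    The flow through [T0] is explicit. Factor [exp(tG) Q0 = Q(t) R(t)] by
    Gram-Schmidt, with [Q] orthogonal and [R] upper triangular with positive
    diagonal; both factors are differentiable ([QR_derivable]). Differentiating
    the factorization gives [Q^T Q' = Q^T G Q - R' R^-1]. The left side is skew
    and [R' R^-1] is upper triangular, so [Q^T Q'] is the skew matrix with the
    strictly lower part of [Q^T G Q = g(S)], where [S = Q^T Lambda Q]; this says
    that [S] solves the differential equation ([QR_toda]). On the other hand
    [exp(tG) Q0 = (exp(tG) L0 exp(-tG)) (exp(tG) U0)], so [Q(t)] is LU-positive
    with lower factor [L(t) = exp(tG) L0 exp(-tG)]: the flow never leaves the
    chart ([toda_flow]), [B = L^-1 Lambda L] is conjugated by [exp(tG)], and each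
    coordinate is multiplied by [exp((g_(i+1) - g_i) t)] ([bidiag_coord_flow]).

    Every solution is of this form. On the isospectral set [g(T)] is a polynomial
    in [T], so the vector field is Lipschitz there and solutions are unique by
    Gronwall's inequality ([toda_unique]); hence solutions have the stated
    coordinates. Conversely, a curve whose coordinates solve the linear system has
    the coordinates of an explicit flow, and the coordinates determine the point
    ([bidiag_coord_inj]): [L1 L2^-1] commutes with [Lambda] when
    [L1^-1 Lambda L1 = L2^-1 Lambda L2], hence is the identity.

    If [g] decreases along [pi], then [L(t)] tends to the identity. Writing
    [L = Q U], with [U] upper triangular with positive diagonal, one has
    [U^T U = L^T L], so [U] and then [Q] tend to the identity ([QR_cvg1]), and
    [T = Q^T Lambda Q] tends to [Lambda]. Finally [T U = U B] shows that
    [T_(k+1,k)] is [beta_k] times a ratio of diagonal entries of [U], which tends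
    to 1 ([chart_L_cvg1]). *)

Set Implicit Arguments.
Unset Strict Implicit.
Unset Printing Implicit Defensive.

Import Order.TTheory GRing.Theory Num.Theory.
Import numFieldNormedType.Exports.

Local Open Scope classical_set_scope.
Local Open Scope ring_scope.

(** * Triangular matrices *)

Lemma trig_mulmx (R : pzRingType) (n : nat) (A B : 'M[R]_n) :
  is_trig_mx A -> is_trig_mx B -> is_trig_mx (A *m B).
Proof.
move=> /is_trig_mxP hA /is_trig_mxP hB; apply/is_trig_mxP => i j ij.
rewrite mxE big1 // => k _; case: (ltnP i k) => ik; first by rewrite hA ?mul0r.
by rewrite hB ?mulr0 // (leq_ltn_trans ik).
Qed.

Lemma trig_mulmx_diag (R : pzRingType) (n : nat) (A B : 'M[R]_n) i :
  is_trig_mx A -> is_trig_mx B -> (A *m B) i i = A i i * B i i.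
Proof.
move=> /is_trig_mxP hA /is_trig_mxP hB.
rewrite mxE (bigD1 i) //= big1 ?addr0 // => k ki.
case: (ltngtP i k) => [ik|ik|/val_inj ik].
- by rewrite hA ?mul0r.
- by rewrite hB ?mulr0.
- by rewrite ik eqxx in ki.
Qed.

(** Forward substitution: row [i] of [X] is determined by row [i] of [L *m X]
    and by the earlier rows of [X]. *)
Lemma trig_mulmx_cancel (F : fieldType) (n : nat) (L X : 'M[F]_n) :
  is_trig_mx L -> (forall i, L i i != 0) -> is_trig_mx (L *m X) ->
  is_trig_mx X.
Proof.
move=> /is_trig_mxP hL hd /is_trig_mxP hLX; apply/is_trig_mxP.
suff H m : forall i j : 'I_n, (i < m)%N -> (i < j)%N -> X i j = 0.
  by move=> i j; apply: (H i.+1).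
elim: m => // m IH i j; rewrite ltnS leq_eqVlt => /orP[/eqP im ij|]; last first.
  by move=> im ij; apply: IH.
have := hLX i j ij; rewrite mxE (bigD1 i) //= big1 ?addr0.
  by move/eqP; rewrite mulf_eq0 (negPf (hd i)) /= => /eqP.
move=> k ki; case: (ltngtP i k) => [ik|ik|/val_inj ik].
- by rewrite hL ?mul0r.
- by rewrite (IH k j) ?mulr0 -?im // (ltn_trans ik).
- by rewrite ik eqxx in ki.
Qed.

Lemma trig_unitmx (F : fieldType) (n : nat) (L : 'M[F]_n) :
  is_trig_mx L -> (forall i, L i i != 0) -> L \in unitmx.
Proof.
move=> hL hd; rewrite unitmxE det_trig // unitfE.
by apply/prodf_neq0 => i _.
Qed.

Lemma trig_invmx (F : fieldType) (n : nat) (L : 'M[F]_n) :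
  is_trig_mx L -> (forall i, L i i != 0) -> is_trig_mx (invmx L).
Proof.
move=> hL hd; apply: (trig_mulmx_cancel hL hd).
by rewrite mulmxV ?trig_unitmx // scalar_mx_is_trig.
Qed.

Lemma trig_invmx_diag (F : fieldType) (n : nat) (L : 'M[F]_n) i :
  is_trig_mx L -> (forall j, L j j != 0) -> invmx L i i = (L i i)^-1.
Proof.
move=> hL hd; have : (L *m invmx L) i i = 1.
  by rewrite mulmxV ?trig_unitmx // mxE eqxx.
rewrite trig_mulmx_diag ?trig_invmx // => h.
by apply: (mulfI (hd i)); rewrite h mulfV.
Qed.

(** With [unit_lower], the two groups whose product is the set of LU-positive
    matrices. *)
Definition upper_posdiag (R : realType) (n : nat) (U : 'M[R]_n) : Prop :=
  is_trig_mx U^T /\ forall i, 0 < U i i.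

Definition unit_lower (R : realType) (n : nat) (L : 'M[R]_n) : Prop :=
  is_trig_mx L /\ forall i, L i i = 1.

Section TriangularGroups.
Variables (R : realType) (n : nat).
Implicit Types L U V : 'M[R]_n.

Lemma upper_posdiag_neq0 U : upper_posdiag U -> forall i, U^T i i != 0.
Proof. by move=> [_ h] i; rewrite mxE gt_eqF. Qed.

Lemma upper_posdiag_unit U : upper_posdiag U -> U \in unitmx.
Proof.
by move=> hU; rewrite -unitmx_tr (trig_unitmx hU.1 (upper_posdiag_neq0 hU)).
Qed.

Lemma upper_posdiagM U V :
  upper_posdiag U -> upper_posdiag V -> upper_posdiag (U *m V).
Proof.
move=> [hU dU] [hV dV]; split; first by rewrite trmx_mul trig_mulmx.
move=> i; have -> : (U *m V) i i = (V^T *m U^T) i i by rewrite -trmx_mul [RHS]mxE.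
by rewrite trig_mulmx_diag // !mxE mulr_gt0.
Qed.

Lemma upper_posdiagV U : upper_posdiag U -> upper_posdiag (invmx U).
Proof.
move=> hU; have h0 := upper_posdiag_neq0 hU; split.
  by rewrite trmx_inv trig_invmx //; case: hU.
move=> i; have -> : (invmx U) i i = invmx U^T i i by rewrite -trmx_inv [RHS]mxE.
by rewrite (trig_invmx_diag _ hU.1) // mxE invr_gt0 hU.2.
Qed.

Lemma upper_posdiag_scale (d : 'rV[R]_n) U :
  (forall i, 0 < d 0 i) -> upper_posdiag U -> upper_posdiag (diag_mx d *m U).
Proof.
move=> hd; apply: upper_posdiagM; split.
  by rewrite tr_diag_mx diag_mx_is_trig.
by move=> i; rewrite mxE eqxx mulr1n.
Qed.

Lemma unit_lower_unit L : unit_lower L -> L \in unitmx.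
Proof. by move=> [h d]; apply: trig_unitmx => // i; rewrite d oner_neq0. Qed.

Lemma unit_lowerM L M : unit_lower L -> unit_lower M -> unit_lower (L *m M).
Proof.
move=> [hL dL] [hM dM]; split; first exact: trig_mulmx.
by move=> i; rewrite trig_mulmx_diag // dL dM mulr1.
Qed.

Lemma unit_lowerV L : unit_lower L -> unit_lower (invmx L).
Proof.
move=> [hL dL]; have h0 i : L i i != 0 by rewrite dL oner_neq0.
split; first exact: trig_invmx.
by move=> i; rewrite trig_invmx_diag // dL invr1.
Qed.

Lemma trig_tr_trig_eq1 (X : 'M[R]_n) :
  is_trig_mx X -> is_trig_mx X^T -> (forall i, X i i = 1) -> X = 1%:M.
Proof.
move=> h1 h2 h; have : is_diag_mx X by rewrite is_diag_mxEtrig h1.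
move/is_diag_mxP => hX; apply/matrixP => i j; rewrite mxE.
by case: eqP => [->|/eqP ij]; [rewrite h|rewrite hX].
Qed.

Lemma orthogonal_mxV Q : orthogonal_mx Q -> Q *m Q^T = 1%:M :> 'M[R]_n.
Proof. exact: mulmx1C. Qed.

Lemma orthogonal_mx_unit Q : orthogonal_mx Q -> (Q : 'M[R]_n) \in unitmx.
Proof. by move=> /mulmx1_unit[]. Qed.

(** An orthogonal upper triangular [W] has [W^T = W^-1] upper triangular too,
    hence is diagonal with entries of square 1. *)
Lemma orthogonal_upper_posdiag W :
  orthogonal_mx W -> upper_posdiag W -> W = 1%:M :> 'M[R]_n.
Proof.
move=> oW uW.
have eV : invmx W = W^T.
  by rewrite -[RHS](mulmxK (orthogonal_mx_unit oW)) oW mul1mx.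
have tW : is_trig_mx W by have [] := upper_posdiagV uW; rewrite eV trmxK.
apply: trig_tr_trig_eq1 => //; first by case: uW.
move=> i; have /matrixP/(_ i i) := oW; rewrite !mxE eqxx.
rewrite (bigD1 i) //= big1 ?addr0.
  rewrite mxE => h; apply/eqP; rewrite -(@eqrXn2 _ 2%N) ?ler01 ?ltW //.
    by rewrite expr2 h expr1n.
  by case: uW.
move=> k ki; rewrite !mxE.
case: (ltngtP i k) => [ik|ik|/val_inj ik].
- have := is_trig_mxP uW.1 i k ik; rewrite mxE => ->; exact: mul0r.
- by rewrite (is_trig_mxP tW) // mul0r.
- by rewrite ik eqxx in ki.
Qed.

Lemma LU_factorsE M L U :
  LU_factors M L U <-> [/\ unit_lower L, upper_posdiag U & M = L *m U].
Proof.
split=> [[h1 h2 h3 h4 h5]|[[h1 h2] [h3 h4] h5]].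
  by split.
by split.
Qed.

(** Both factors are compared at once, up to a diagonal matrix [diag_mx e] of
    signs: [L2^-1 diag(e) L1 = U2 U1^-1] is lower and upper triangular, and its
    diagonal is that of [diag_mx e] on one side and positive on the other. *)
Lemma LU_compare (e : 'rV[R]_n) L1 U1 L2 U2 :
  unit_lower L1 -> upper_posdiag U1 -> unit_lower L2 -> upper_posdiag U2 ->
  diag_mx e *m (L1 *m U1) = L2 *m U2 -> forall i, 0 < e 0 i.
Proof.
move=> hL1 hU1 hL2 hU2 eq i.
have eqX : invmx L2 *m (diag_mx e *m L1) = U2 *m invmx U1.
  have := congr1 (fun X => invmx L2 *m X *m invmx U1) eq.
  rewrite !mulmxA (mulmxK (upper_posdiag_unit hU1)) => ->.
  by rewrite (mulVmx (unit_lower_unit hL2)) mul1mx.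
have [t2 d2] := unit_lowerV hL2.
have : 0 < (U2 *m invmx U1) i i.
  by have [] := upper_posdiagM hU2 (upper_posdiagV hU1).
have [t1 d1] := hL1; have tD : is_trig_mx (diag_mx e) by apply: diag_mx_is_trig.
rewrite -eqX !trig_mulmx_diag ?trig_mulmx //.
by rewrite d2 d1 mul1r mulr1 mxE eqxx mulr1n.
Qed.

Lemma LU_unique L1 U1 L2 U2 :
  unit_lower L1 -> upper_posdiag U1 -> unit_lower L2 -> upper_posdiag U2 ->
  L1 *m U1 = L2 *m U2 -> L1 = L2.
Proof.
move=> hL1 hU1 hL2 hU2 eq.
have eqX : invmx L2 *m L1 = U2 *m invmx U1.
  have := congr1 (fun X => invmx L2 *m X *m invmx U1) eq.
  rewrite !mulmxA (mulmxK (upper_posdiag_unit hU1)) => ->.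
  by rewrite (mulVmx (unit_lower_unit hL2)) mul1mx.
have [t1 d1] := unit_lowerM (unit_lowerV hL2) hL1.
have [t2 _] := upper_posdiagM hU2 (upper_posdiagV hU1).
have : invmx L2 *m L1 = 1%:M by apply: trig_tr_trig_eq1 => //; rewrite eqX.
move/(congr1 (mulmx L2)); rewrite mulmxA mulmxV ?unit_lower_unit //.
by rewrite mul1mx mulmx1.
Qed.

Lemma L_factorE M L U : LU_factors M L U -> L_factor M = L.
Proof.
move=> h; apply: xget_unique; first by exists U.
move=> L' [U' /LU_factorsE[h1 h2 h3]].
by case/LU_factorsE: h => h4 h5 h6; apply: (LU_unique h1 h2 h4 h5); rewrite -h3.
Qed.

End TriangularGroups.

(** * Diagonalizations and functional calculus *)

Lemma sqnorm_gt0 (R : realType) (m : nat) (c : 'cV[R]_m) : c != 0 -> 0 < (c^T *m c) 0 0.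
Proof.
move=> c0; have -> : (c^T *m c) 0 0 = \sum_k c k 0 ^+ 2.
  by rewrite mxE; apply: eq_bigr => k _; rewrite mxE expr2.
rewrite lt_neqAle sumr_ge0 ?andbT; last by move=> k _; apply: sqr_ge0.
apply: contra_neq c0 => /esym/eqP; rewrite psumr_eq0.
  move=> /allP h; apply/colP => k; apply/eqP; rewrite mxE.
  by have := h k (mem_index_enum k); rewrite sqrf_eq0.
by move=> k _; apply: sqr_ge0.
Qed.

Section Diagonalization.
Variables (R : realType) (n : nat).

Lemma commute_diag_mx (F : fieldType) (d : 'rV[F]_n) (X : 'M[F]_n) :
  injective (d 0) -> X *m diag_mx d = diag_mx d *m X -> is_diag_mx X.
Proof.
move=> inj eq; apply/is_diag_mxP => i j ij.
have /matrixP/(_ i j) := eq; rewrite mul_mx_diag mul_diag_mx !mxE => /eqP.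
rewrite mulrC -subr_eq0 -mulrBl mulf_eq0 subr_eq0 => /orP[/eqP/inj e|/eqP//].
by rewrite e eqxx in ij.
Qed.

(** Two orthogonal diagonalizations differ by a matrix whose entries vanish
    between distinct eigenvalues, so it intertwines [g] of the eigenvalues. *)
Lemma fun_calculusE (g : R -> R) (T Q : 'M[R]_n) (d : 'rV[R]_n) :
  orthogonal_mx Q -> T = Q^T *m diag_mx d *m Q ->
  fun_calculus g T = Q^T *m diag_mx (map_mx g d) *m Q.
Proof.
move=> oQ eT; apply: xget_unique; first by exists Q, d.
move=> G [Q' [d' [oQ' eT' ->]]].
pose X := Q *m Q'^T.
have XD (e e' : 'rV[R]_n) : Q^T *m diag_mx e *m Q = Q'^T *m diag_mx e' *m Q' <->
    X *m diag_mx e' = diag_mx e *m X.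
  have h1 := orthogonal_mxV oQ; have h2 := orthogonal_mxV oQ'.
  split=> h.
    rewrite -[RHS]mul1mx -h1 -!mulmxA (mulmxA Q^T) (mulmxA _ Q) h.
    by rewrite !mulmxA -(mulmxA _ Q' Q'^T) h2 mulmx1.
  rewrite -[LHS]mulmx1 -oQ' -!mulmxA (mulmxA Q) (mulmxA (diag_mx e)) -h /X.
  by rewrite !mulmxA oQ mul1mx.
apply/esym/XD/matrixP => i j.
have /matrixP/(_ i j) : X *m diag_mx d' = diag_mx d *m X.
  by apply/XD; rewrite -eT.
rewrite !mul_mx_diag !mul_diag_mx !mxE => /eqP.
rewrite mulrC -subr_eq0 -mulrBl mulf_eq0 subr_eq0.
move=> /orP[/eqP->|/eqP->]; first by rewrite mulrC.
by rewrite mul0r mulr0.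
Qed.

Variable lam : 'I_n -> R.
Hypothesis lam_inj : injective lam.

(** If [P T = Lambda P] with [T] symmetric, then [P P^T] commutes with [Lambda],
    so the rows of [P] are orthogonal and it remains to normalize them. *)
Lemma isospectral_diag (T : 'M[R]_n) : isospectral lam T ->
  exists2 Q : 'M[R]_n, orthogonal_mx Q
    & T = Q^T *m diag_mx (\row_i lam i) *m Q.
Proof.
move=> [sT _ [P uP /(similarP uP)]]; set D := diag_mx _ => PT.
have TP : T *m P^T = P^T *m D.
  by rewrite -[in LHS]sT -trmx_mul PT trmx_mul tr_diag_mx.
have dPP : is_diag_mx (P *m P^T).
  apply: (@commute_diag_mx _ (\row_i lam i)).
    by move=> i j; rewrite !mxE; apply: lam_inj.
  by rewrite -mulmxA -TP mulmxA PT mulmxA.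
have [X XE] : exists X, X = P *m P^T by exists (P *m P^T).
pose s i := X i i.
have s_gt0 i : 0 < s i.
  have rP : (row i P)^T != 0.
    apply/negP => /eqP/(congr1 trmx); rewrite trmxK trmx0 => rP.
    have : row i (P *m invmx P) = 0 by rewrite row_mul rP mul0mx.
    by rewrite mulmxV // => /rowP/(_ i)/eqP; rewrite !mxE eqxx oner_eq0.
  suff -> : s i = ((row i P)^T^T *m (row i P)^T) 0 0 by apply: sqnorm_gt0.
  by rewrite trmxK /s XE !mxE; apply: eq_bigr => k _; rewrite !mxE.
pose e := \row_i (Num.sqrt (s i))^-1.
pose Q := diag_mx e *m P.
have oQ : Q *m Q^T = 1%:M.
  rewrite /Q trmx_mul tr_diag_mx -mulmxA (mulmxA P) mulmxA -XE.
  rewrite mul_mx_diag mul_diag_mx.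
  apply/matrixP => i j; rewrite !mxE.
  have [->|ij] := eqVneq i j.
    rewrite -/(s j) mulrAC -invfM -expr2.
    by rewrite sqr_sqrtr ?ltW // mulVf // gt_eqF.
  by rewrite XE (is_diag_mxP dPP) // mulr0 mul0r.
exists Q; first exact: mulmx1C.
have QT : Q *m T = D *m Q by rewrite /Q -mulmxA PT !mulmxA diag_mxC.
by rewrite -(mulmxA Q^T D Q) -QT mulmxA (mulmx1C oQ) mul1mx.
Qed.

Lemma interpolation (c : 'I_n -> R) :
  exists p : {poly R}, forall i, p.[lam i] = c i.
Proof.
exists (\sum_i c i *: \prod_(j | j != i) ((lam i - lam j)^-1 *: ('X - (lam j)%:P))).
move=> k; rewrite horner_sum (bigD1 k) //= [X in _ + X]big1 ?addr0; last first.
  move=> i ik; rewrite hornerZ horner_prod (bigD1 k) 1?eq_sym //= hornerZ.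
  by rewrite hornerXsubC subrr mulr0 mul0r mulr0.
rewrite hornerZ horner_prod big1 ?mulr1 // => j jk.
rewrite hornerZ hornerXsubC mulVf // subr_eq0.
by apply: contra_neq jk => /lam_inj.
Qed.

End Diagonalization.

Lemma fun_calculus_horner (R : realType) (n : nat) (lam : 'I_n.+1 -> R)
    (g : R -> R) (p : {poly R}) (T : 'M[R]_n.+1) :
  injective lam -> (forall i, p.[lam i] = g (lam i)) -> isospectral lam T ->
  fun_calculus g T = horner_mx T p.
Proof.
move=> linj hp /(isospectral_diag linj)[Q oQ eT].
rewrite (fun_calculusE g oQ eT) {}eT.
have uQ := orthogonal_mx_unit oQ.
have uQt : Q^T \in unitmx by rewrite unitmx_tr.
have Qinv : invmx Q^T = Q.
  by rewrite -[LHS]mulmx1 -oQ (mulKmx uQt).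
rewrite -[X in horner_mx (_ *m X) _]Qinv horner_mx_uconj // Qinv.
congr (_ *m _ *m _); rewrite horner_mx_diag; congr diag_mx.
by apply/rowP => i; rewrite !mxE hp.
Qed.

(** * The bidiagonal chart *)

Definition upper_hessenberg (R : realType) (n : nat) (A : 'M[R]_n) : Prop :=
  forall i j : 'I_n, (j.+1 < i)%N -> A i j = 0.

Lemma upper_hessenberg_mull (R : realType) (n : nat) (U A : 'M[R]_n) :
  is_trig_mx U^T -> upper_hessenberg A -> upper_hessenberg (U *m A).
Proof.
move=> /is_trig_mxP hU hA i j ji; rewrite mxE big1 // => k _.
case: (ltnP k i) => ki; first by have := hU k i ki; rewrite mxE => ->; rewrite mul0r.
by rewrite hA ?mulr0 // (leq_trans ji).
Qed.

Lemma upper_hessenberg_mulr (R : realType) (n : nat) (U A : 'M[R]_n) :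
  is_trig_mx U^T -> upper_hessenberg A -> upper_hessenberg (A *m U).
Proof.
move=> /is_trig_mxP hU hA i j ji; rewrite mxE big1 // => k _.
case: (ltnP j k) => ki; first by have := hU j k ki; rewrite mxE => ->; rewrite mulr0.
by rewrite hA ?mul0r // (leq_ltn_trans _ ji) // ltnS.
Qed.

Lemma tridiagonal_sym (R : realType) (n : nat) (T : 'M[R]_n) :
  T^T = T -> upper_hessenberg T -> tridiagonal T.
Proof.
move=> sT hT i j /orP[ij|ij]; last exact: hT.
by rewrite -sT mxE hT.
Qed.

Lemma isospectral_conj (R : realType) (n : nat) (lam : 'I_n -> R)
    (T W : 'M[R]_n) :
  isospectral lam T -> orthogonal_mx W -> tridiagonal (W^T *m T *m W) ->
  isospectral lam (W^T *m T *m W).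
Proof.
move=> [sT tT [P uP /(similarP uP) eL]] oW tW; split=> //.
  by rewrite !trmx_mul trmxK sT mulmxA.
have uPW : P *m W \in unitmx by rewrite unitmx_mul uP orthogonal_mx_unit.
exists (P *m W) => //; apply/(similarP uPW).
rewrite !mulmxA -(mulmxA P W) (orthogonal_mxV oW) mulmx1 eL.
by [].
Qed.

(** The [L_pi] of the chart: the coordinates of [T] are the subdiagonal of
    [L_pi^-1 Lambda^pi L_pi]. *)
Definition chart_L (R : realType) (n : nat) (lam : 'I_n -> R) (pi : 'S_n)
    (T : 'M[R]_n) : 'M[R]_n := L_factor (chart_Q lam pi T).

Section Chart.
Variables (R : realType) (n : nat) (lam : 'I_n -> R) (pi : 'S_n).
Hypothesis lam_inj : injective lam.
Implicit Types T Q L U : 'M[R]_n.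
Local Notation D := (diag_perm lam pi).

Lemma commute_diag_perm X : X *m D = D *m X -> is_diag_mx X.
Proof.
apply: commute_diag_mx => i j; rewrite !mxE => /lam_inj; exact: perm_inj.
Qed.

(** The rows of [Q] are eigenvectors, determined up to sign; LU-positivity
    picks the signs. *)
Lemma chart_frame_unique T Q1 Q2 :
  chart_frame lam pi T Q1 -> chart_frame lam pi T Q2 -> Q1 = Q2.
Proof.
move=> [ o1 [L1 [U1 /LU_factorsE[hL1 hU1 e1]]] t1].
move=> [ o2 [L2 [U2 /LU_factorsE[hL2 hU2 e2]]] t2].
have eqT : Q1^T *m D *m Q1 = Q2^T *m D *m Q2 by rewrite -t1 -t2.
have : is_diag_mx (Q2 *m Q1^T).
  apply: commute_diag_perm.
  have := congr1 (fun X => Q2 *m X *m Q1^T) eqT.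
  rewrite !mulmxA (orthogonal_mxV o2) mul1mx => <-.
  by rewrite -!mulmxA (orthogonal_mxV o1) mulmx1.
move=> /diag_mxP[e ee].
have eQ : diag_mx e *m Q1 = Q2 by rewrite -ee -mulmxA o1 mulmx1.
have e_gt0 : forall i, 0 < e 0 i.
  by apply: (LU_compare hL1 hU1 hL2 hU2); rewrite -e1 -e2.
suff e1' : diag_mx e = 1%:M by rewrite -eQ e1' mul1mx.
apply: orthogonal_upper_posdiag.
  rewrite /orthogonal_mx -ee trmx_mul trmxK -mulmxA (mulmxA Q2^T) o2 mul1mx.
  exact: orthogonal_mxV.
split; first by rewrite tr_diag_mx diag_mx_is_trig.
by move=> i; rewrite mxE eqxx mulr1n.
Qed.

Lemma chart_LE T L U :
  unit_lower L -> upper_posdiag U -> orthogonal_mx (L *m U) ->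
  T = (L *m U)^T *m D *m (L *m U) -> chart_L lam pi T = L.
Proof.
move=> hL hU oQ eT; have hLU : LU_factors (L *m U) L U by apply/LU_factorsE.
have cQ : chart_frame lam pi T (L *m U) by split=> //; exists L, U.
rewrite /chart_L -[RHS](L_factorE hLU); congr L_factor.
by apply: xget_unique => // Q' cQ'; apply: chart_frame_unique cQ' cQ.
Qed.

Lemma chart_domain_LU T : chart_domain lam pi T ->
  exists U, [/\ unit_lower (chart_L lam pi T), upper_posdiag U,
    orthogonal_mx (chart_L lam pi T *m U)
    & T = (chart_L lam pi T *m U)^T *m D *m (chart_L lam pi T *m U)].
Proof.
move=> [_ [Q [ oQ [L [U /LU_factorsE[hL hU eQ]]] eT]]].
rewrite eQ in oQ eT.
by exists U; rewrite (chart_LE hL hU oQ eT).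
Qed.

Section Bidiagonal.
Variables (L U : 'M[R]_n).
Hypotheses (hL : unit_lower L) (hU : upper_posdiag U).
Let B := invmx L *m D *m L.

Lemma bidiagonal_trig : is_trig_mx B.
Proof.
have [tL _] := hL; have [tV _] := unit_lowerV hL.
by rewrite !trig_mulmx ?diag_mx_is_trig.
Qed.

Lemma bidiagonal_diag i : B i i = lam (pi i).
Proof.
have [tL dL] := hL; have [tV dV] := unit_lowerV hL.
rewrite !trig_mulmx_diag ?trig_mulmx ?diag_mx_is_trig //.
by rewrite dL dV mul1r mulr1 !mxE eqxx mulr1n.
Qed.

Hypothesis oQ : orthogonal_mx (L *m U).
Let T := (L *m U)^T *m D *m (L *m U).

(** [T] and [B] are conjugate by the upper triangular [U], so they have the
    same lower bandwidth: this is why [B] is bidiagonal exactly when [T] is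
    tridiagonal. *)
Lemma bidiagonal_intertwine : U *m T = B *m U.
Proof.
have uL := unit_lower_unit hL; have := orthogonal_mxV oQ.
rewrite /T /B => /(congr1 (mulmx (invmx L))); rewrite !mulmxA (mulVmx uL).
by rewrite !mul1mx mulmx1 => ->.
Qed.

Lemma bidiagonal_hessenberg : upper_hessenberg T <-> upper_hessenberg B.
Proof.
have uU := upper_posdiag_unit hU; have [tU _] := hU.
have [tV _] := upper_posdiagV hU.
have eB : B = U *m T *m invmx U by rewrite bidiagonal_intertwine mulmxK.
have eT : T = invmx U *m (B *m U) by rewrite -bidiagonal_intertwine mulKmx.
split=> h.
  by rewrite eB; apply: upper_hessenberg_mulr => //; apply: upper_hessenberg_mull.
by rewrite eT; apply: upper_hessenberg_mull => //; apply: upper_hessenberg_mulr.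
Qed.

End Bidiagonal.

(** [L] is recovered from [B = L^-1 Lambda L] since [L1 L2^-1] commutes with
    [Lambda]. *)
Lemma conj_diag_inj L1 L2 : unit_lower L1 -> unit_lower L2 ->
  invmx L1 *m D *m L1 = invmx L2 *m D *m L2 -> L1 = L2.
Proof.
move=> h1 h2 eq; have u1 := unit_lower_unit h1; have u2 := unit_lower_unit h2.
have hX : unit_lower (L1 *m invmx L2).
  exact: unit_lowerM h1 (unit_lowerV h2).
have : is_diag_mx (L1 *m invmx L2).
  apply: commute_diag_perm; apply/esym.
  have := congr1 (fun X => L1 *m X *m invmx L2) eq.
  by rewrite /= !mulmxA (mulmxV u1) mul1mx (mulmxK u2).
rewrite is_diag_mxEtrig => /andP[_ tX].
have : L1 *m invmx L2 = 1%:M by apply: trig_tr_trig_eq1 tX _; case: hX.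
by move/(congr1 (mulmx^~ L2)); rewrite /= (mulmxKV u2) mul1mx.
Qed.

Lemma eq_bidiagonal (B1 B2 : 'M[R]_n) :
  is_trig_mx B1 -> is_trig_mx B2 ->
  upper_hessenberg B1 -> upper_hessenberg B2 ->
  (forall i, B1 i i = B2 i i) ->
  (forall k : 'I_n.-1, B1 (ord_next k) (ord_this k) = B2 (ord_next k) (ord_this k)) ->
  B1 = B2.
Proof.
move=> /is_trig_mxP t1 /is_trig_mxP t2 h1 h2 d s; apply/matrixP => i j.
case: (ltngtP i j) => [ij|ji|/val_inj->]; last exact: d.
  by rewrite t1 // t2.
move: ji; rewrite leq_eqVlt => /orP[/eqP e|ji]; last by rewrite h1 // h2.
have hj : (j < n.-1)%N by rewrite -subn1 ltn_subRL add1n e.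
have := s (Ordinal hj).
have -> : ord_next (Ordinal hj) = i by apply: val_inj.
by have -> : ord_this (Ordinal hj) = j by apply: val_inj.
Qed.

Lemma isospectral_hessenberg T : isospectral lam T -> upper_hessenberg T.
Proof. by move=> [_ tT _] i j ij; rewrite tT // ij orbT. Qed.

(** The coordinates determine [B], which determines [L]; the upper factor is
    then determined by orthogonality of [L *m U]. *)
Lemma bidiag_coord_inj T1 T2 :
  chart_domain lam pi T1 -> chart_domain lam pi T2 ->
  (forall k, bidiag_coord lam pi T1 k = bidiag_coord lam pi T2 k) -> T1 = T2.
Proof.
move=> c1 c2 eq; have [U1 [hL1 hU1 o1 e1]] := chart_domain_LU c1.
have [U2 [hL2 hU2 o2 e2]] := chart_domain_LU c2.
have eL : chart_L lam pi T1 = chart_L lam pi T2.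
  apply: conj_diag_inj => //; apply: eq_bidiagonal => //.
  - exact: bidiagonal_trig.
  - exact: bidiagonal_trig.
  - apply/(bidiagonal_hessenberg hL1 hU1 o1); rewrite -e1.
    by case: c1 => /isospectral_hessenberg.
  - apply/(bidiagonal_hessenberg hL2 hU2 o2); rewrite -e2.
    by case: c2 => /isospectral_hessenberg.
  - by move=> i; rewrite !bidiagonal_diag.
have u1 := upper_posdiag_unit hU1.
rewrite eL in hL1 o1 e1.
have eW : invmx U1 *m U2 =
    (chart_L lam pi T2 *m U1)^T *m (chart_L lam pi T2 *m U2).
  have -> : chart_L lam pi T2 *m U2 = chart_L lam pi T2 *m U1 *m (invmx U1 *m U2).
    by rewrite -mulmxA (mulKVmx u1).
  by rewrite mulmxA o1 mul1mx.
have : invmx U1 *m U2 = 1%:M.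
  apply: orthogonal_upper_posdiag; last first.
    exact: upper_posdiagM (upper_posdiagV hU1) hU2.
  rewrite /orthogonal_mx eW trmx_mul trmxK -mulmxA (mulmxA _ _^T).
  by rewrite (orthogonal_mxV o1) mul1mx.
move/(congr1 (mulmx U1)); rewrite (mulKVmx u1) mulmx1 => eU.
by rewrite e1 [RHS]e2 eU.
Qed.

End Chart.

(** * Differentiable families of matrices *)

Section DeriveMatrix.
Variable R : realType.

Lemma is_derive_mxP (m n : nat) (M : R -> 'M[R]_(m, n)) (t : R) (D : 'M[R]_(m, n)) :
  is_derive t 1 M D <->
  forall i j, is_derive t 1 (fun s => M s i j) (D i j).
Proof.
split=> [[dM <-] i j|H].
  rewrite derive_mx // mxE; apply: DeriveDef => //.
  exact: (derivable_mxP M t 1).1.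
have dM : derivable M t 1 by apply/derivable_mxP => i j; case: (H i j).
apply: DeriveDef => //; rewrite derive_mx //; apply/matrixP => i j.
by rewrite mxE; case: (H i j).
Qed.

Lemma is_derive_sumE (I : finType) (f : I -> R -> R) (df : I -> R) (t : R) :
  (forall i, is_derive t 1 (f i) (df i)) ->
  is_derive t 1 (fun s => \sum_i f i s) (\sum_i df i).
Proof.
move=> H; have -> : (fun s => \sum_i f i s) = \sum_i f i.
  by apply/funext => s; rewrite fct_sumE.
by elim/big_ind2 : _ => // [|] *; [exact: is_derive_cst|exact: is_deriveD].
Qed.

Lemma is_derive_mulE (f g : R -> R) (df dg t : R) :
  is_derive t 1 f df -> is_derive t 1 g dg ->
  is_derive t 1 (fun s => f s * g s) (df * g t + f t * dg).
Proof.
move=> hf hg; apply: is_derive_eq (is_deriveM hf hg) _.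
by rewrite /GRing.scale /= addrC (mulrC (g t)).
Qed.

Lemma is_derive_mul_expR (f : R -> R) (df a t0 t : R) :
  is_derive t 1 f df ->
  is_derive t 1 (fun s => f s * expR (a * (s - t0)))
    ((df + a * f t) * expR (a * (t - t0))).
Proof.
move=> hf; have hl : is_derive t 1 (fun s : R => a * (s - t0)) a.
  have h := is_derive_mulE (is_derive_cst a t 1)
    (is_deriveB (is_derive_id t 1) (is_derive_cst t0 t 1)).
  by apply: is_derive_eq h _; rewrite mul0r add0r subr0 mulr1.
have he := @is_derive1_comp _ expR (fun s : R => a * (s - t0)) t _ _
  (is_derive_expR (a * (t - t0))) hl.
by apply: is_derive_eq (is_derive_mulE hf he) _ => /=; ring.
Qed.

Lemma is_derive_mulmx (m n p : nat) (M : R -> 'M[R]_(m, n))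
    (N : R -> 'M[R]_(n, p)) dM dN (t : R) :
  is_derive t 1 M dM -> is_derive t 1 N dN ->
  is_derive t 1 (fun s => M s *m N s) (dM *m N t + M t *m dN).
Proof.
move=> /is_derive_mxP hM /is_derive_mxP hN; apply/is_derive_mxP => i j.
under eq_fun do rewrite mxE; rewrite !mxE -big_split /=.
by apply: is_derive_sumE => k; apply: is_derive_mulE.
Qed.

Lemma is_derive_trmx (m n : nat) (M : R -> 'M[R]_(m, n)) dM (t : R) :
  is_derive t 1 M dM -> is_derive t 1 (fun s => (M s)^T) dM^T.
Proof.
move=> /is_derive_mxP hM; apply/is_derive_mxP => i j.
by under eq_fun do rewrite mxE; rewrite mxE.
Qed.

Lemma derivable_mulmx (m n p : nat) (M : R -> 'M[R]_(m, n))
    (N : R -> 'M[R]_(n, p)) (t : R) :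
  derivable M t 1 -> derivable N t 1 -> derivable (fun s => M s *m N s) t 1.
Proof. by move=> /derivableP hM /derivableP hN; case: (is_derive_mulmx hM hN). Qed.

Lemma derivable_trmx (m n : nat) (M : R -> 'M[R]_(m, n)) (t : R) :
  derivable M t 1 -> derivable (fun s => (M s)^T) t 1.
Proof. by move=> /derivableP hM; case: (is_derive_trmx hM). Qed.

Lemma derivable_scalemx (m n : nat) (a : R -> R) (M : R -> 'M[R]_(m, n)) (t : R) :
  derivable a t 1 -> derivable M t 1 -> derivable (fun s => a s *: M s) t 1.
Proof.
move=> ha /derivable_mxP hM; apply/derivable_mxP => i j.
by under eq_fun do rewrite mxE; apply: derivableM.
Qed.

Lemma derivable_block_mx (m1 m2 n1 n2 : nat) (A : R -> 'M[R]_(m1, n1))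
    (B : R -> 'M[R]_(m1, n2)) (C : R -> 'M[R]_(m2, n1)) (D : R -> 'M[R]_(m2, n2))
    (t : R) :
  derivable A t 1 -> derivable B t 1 -> derivable C t 1 -> derivable D t 1 ->
  derivable (fun s => block_mx (A s) (B s) (C s) (D s)) t 1.
Proof.
move=> /derivable_mxP hA /derivable_mxP hB /derivable_mxP hC /derivable_mxP hD.
apply/derivable_mxP => i j.
case: (split_ordP i) => i' ->; case: (split_ordP j) => j' ->.
- by under eq_fun do rewrite block_mxEul; exact: hA.
- by under eq_fun do rewrite block_mxEur; exact: hB.
- by under eq_fun do rewrite block_mxEdl; exact: hC.
- by under eq_fun do rewrite block_mxEdr; exact: hD.
Qed.

Lemma derivable_row_mx (m n1 n2 : nat) (A : R -> 'M[R]_(m, n1))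
    (B : R -> 'M[R]_(m, n2)) (t : R) :
  derivable A t 1 -> derivable B t 1 -> derivable (fun s => row_mx (A s) (B s)) t 1.
Proof.
move=> /derivable_mxP hA /derivable_mxP hB; apply/derivable_mxP => i j.
case: (split_ordP j) => j' ->.
- by under eq_fun do rewrite row_mxEl; exact: hA.
- by under eq_fun do rewrite row_mxEr; exact: hB.
Qed.

Lemma derivable_sqrt (f : R -> R) (t : R) :
  0 < f t -> derivable f t 1 -> derivable (fun s => Num.sqrt (f s)) t 1.
Proof.
move=> f0 /derivableP hf.
by case: (is_derive1_comp (is_derive1_sqrt f0) hf).
Qed.

Lemma derivable_inv (f : R -> R) (t : R) :
  f t != 0 -> derivable f t 1 -> derivable (fun s => (f s)^-1) t 1.
Proof. by move=> f0 hf; apply: derivableV. Qed.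

(** Gram-Schmidt on the columns: normalize the first one, project the others
    on its orthogonal complement, and recurse. Each step only uses operations
    that preserve differentiability, because the norms do not vanish. *)
Lemma QR_derivable (m n : nat) (M : R -> 'M[R]_(m, n)) :
  (forall t, derivable M t 1) -> (forall t (v : 'cV_n), M t *m v = 0 -> v = 0) ->
  exists (Q : R -> 'M[R]_(m, n)) (U : R -> 'M[R]_n),
    [/\ forall t, derivable Q t 1, forall t, derivable U t 1,
        forall t, (Q t)^T *m Q t = 1%:M, forall t, upper_posdiag (U t)
      & forall t, M t = Q t *m U t].
Proof.
elim: n M => [|n IH] M dM kM.
  exists M, (fun=> 1%:M); split=> //.
  - by move=> t; apply/matrixP => -[].
  - by move=> t; split=> [|[]//]; apply/is_trig_mxP => -[].
  - by move=> t; rewrite mulmx1.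
pose c t : 'cV[R]_m := @lsubmx _ m 1 n (M t).
pose N t : 'M[R]_(m, n) := @rsubmx _ m 1 n (M t).
have ME t : M t = row_mx (c t) (N t) by rewrite hsubmxK.
have kM' t (v : 'M[R]_(1 + n, 1)) : row_mx (c t) (N t) *m v = 0 -> v = 0.
  by rewrite -ME; apply: kM.
have dc t : derivable c t 1.
  apply/derivable_mxP => i j; under eq_fun do rewrite mxE.
  exact: (derivable_mxP M t 1).1 (dM t) _ _.
have dN t : derivable N t 1.
  apply/derivable_mxP => i j; under eq_fun do rewrite mxE.
  exact: (derivable_mxP M t 1).1 (dM t) _ _.
pose r t := Num.sqrt (((c t)^T *m c t) 0 0).
have c_gt0 t : 0 < ((c t)^T *m c t) 0 0.
  apply: sqnorm_gt0; apply/negP => /eqP c0.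
  have : @col_mx R 1 n 1 1%:M 0 = 0.
    by apply: (kM' t); rewrite mul_row_col mulmx0 addr0 mulmx1.
  move/colP/(_ (lshift n 0)); rewrite col_mxEu !mxE => /eqP.
  by rewrite oner_eq0.
have r_gt0 t : 0 < r t by rewrite sqrtr_gt0.
have dr t : derivable r t 1.
  apply: derivable_sqrt => //.
  apply: (derivable_mxP (fun t => (c t)^T *m c t) t 1).1.
  by apply: derivable_mulmx => //; apply: derivable_trmx.
pose q t := (r t)^-1 *: c t.
have dq t : derivable q t 1.
  by apply: derivable_scalemx => //; apply: derivable_inv; rewrite ?gt_eqF.
have qq t : (q t)^T *m q t = 1%:M.
  have -> : (q t)^T = (r t)^-1 *: (c t)^T by apply/matrixP => i j; rewrite !mxE.
  rewrite /q -scalemxAl -scalemxAr scalerA.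
  rewrite [_ *m _]mx11_scalar -mul_scalar_mx -scalar_mxM -invfM -expr2.
  by rewrite sqr_sqrtr ?ltW // mulVf // gt_eqF.
pose w t := (q t)^T *m N t.
have dw t : derivable w t 1.
  by apply: derivable_mulmx => //; apply: derivable_trmx.
have [|t v|Q [U [dQ dU QQ hU NE]]] := IH (fun t => N t - q t *m w t).
- by move=> t; apply: derivableB => //; apply: derivable_mulmx.
- move=> Nv.
  have : @col_mx R 1 n 1 (- (r t)^-1 *: (w t *m v)) v = 0.
    apply: (kM' t); rewrite mul_row_col -Nv mulmxBl -scalemxAr.
    rewrite scaleNr scalemxAl -/(q t) mulmxA addrC.
    by [].
  by move=> /eqP; rewrite col_mx_eq0 => /andP[_ /eqP].
have qQ t : (q t)^T *m Q t = 0.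
  have uU := upper_posdiag_unit (hU t).
  rewrite -[LHS](mulmxK uU) -(mulmxA _ (Q t)) -NE mulmxBr mulmxA qq mul1mx subrr.
  by rewrite mul0mx.
exists (fun t => row_mx (q t) (Q t)).
exists (fun t => block_mx (r t)%:M (w t) 0 (U t)); split=> t.
- exact: (@derivable_row_mx m 1 n q Q).
- apply: (@derivable_block_mx 1 n 1 n (fun t => (r t)%:M) w (fun=> 0) U) => //.
  apply/derivable_mxP => i j; rewrite !ord1.
  by under eq_fun do rewrite mxE eqxx mulr1n; exact: dr.
- suff H : (row_mx (q t) (Q t))^T *m row_mx (q t) (Q t) = 1%:M by exact: H.
  rewrite tr_row_mx mul_col_row qq QQ qQ.
  have -> : (Q t)^T *m q t = 0 by rewrite -[LHS]trmxK trmx_mul trmxK qQ trmx0.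
  by rewrite -scalar_mx_block.
- suff H : upper_posdiag (block_mx (r t)%:M (w t) 0 (U t)) by exact: H.
  have [tU pU] := hU t; split.
    rewrite tr_block_mx is_trig_block_mx // trmx0 eqxx tr_scalar_mx.
    by rewrite scalar_mx_is_trig.
  move=> i; case: (split_ordP i) => i' ->; last by rewrite block_mxEdr.
  by rewrite block_mxEul ord1 mxE eqxx mulr1n.
- suff H : row_mx (c t) (N t) =
    row_mx (q t) (Q t) *m block_mx (r t)%:M (w t) 0 (U t) by rewrite ME; exact: H.
  rewrite mul_row_block mulmx0 addr0 -NE addrCA subrr addr0.
  rewrite mul_mx_scalar /q scalerA mulfV ?scale1r //.
  by rewrite gt_eqF.
Qed.

End DeriveMatrix.

(** * The explicit flow in a chart *)

Definition exp_diag (R : realType) (n : nat) (c : 'I_n -> R) (s : R) : 'M[R]_n :=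
  diag_mx (\row_i expR (c i * s)).

Section ExpDiag.
Variables (R : realType) (n : nat) (c : 'I_n -> R).

Lemma exp_diagV s : exp_diag c s *m exp_diag c (- s) = 1%:M.
Proof.
rewrite mulmx_diag; apply/matrixP => i j; rewrite !mxE.
by rewrite -expRD mulrN subrr expR0.
Qed.

Lemma exp_diagVl s : exp_diag c (- s) *m exp_diag c s = 1%:M.
Proof. by rewrite -{2}(opprK s) exp_diagV. Qed.

Lemma exp_diag0 : exp_diag c 0 = 1%:M.
Proof. by apply/matrixP => i j; rewrite !mxE mulr0 expR0. Qed.

Lemma exp_diag_conjE s (A : 'M[R]_n) i j :
  (exp_diag c s *m A *m exp_diag c (- s)) i j = expR ((c i - c j) * s) * A i j.
Proof.
rewrite mul_mx_diag mul_diag_mx !mxE mulrAC -expRD; congr (expR _ * _).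
by rewrite mulrN -mulrBl.
Qed.

Lemma unit_lower_conj s (L : 'M[R]_n) :
  unit_lower L -> unit_lower (exp_diag c s *m L *m exp_diag c (- s)).
Proof.
move=> [/is_trig_mxP tL dL]; split.
  by apply/is_trig_mxP => i j ij; rewrite exp_diag_conjE tL ?mulr0.
by move=> i; rewrite exp_diag_conjE dL subrr mul0r expR0 mulr1.
Qed.

Lemma is_derive_exp_diag (t0 t : R) :
  is_derive t 1 (fun s => exp_diag c (s - t0))
    (diag_mx (\row_i c i) *m exp_diag c (t - t0)).
Proof.
apply/is_derive_mxP => i j; rewrite mul_diag_mx !mxE.
under eq_fun do rewrite !mxE; case: eqP => [->|_]; last first.
  by rewrite !mulr0n mulr0; apply: is_derive_cst.
rewrite !mulr1n.
have h := is_derive_mul_expR (c j) t0 (is_derive_cst (1 : R) t 1).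
have -> : (fun s => expR (c j * (s - t0))) =
    (fun s => cst 1 s * expR (c j * (s - t0))).
  by apply/funext => s; rewrite mul1r.
by apply: is_derive_eq h _; rewrite add0r mulr1.
Qed.

End ExpDiag.

Section SkewFromOrthogonal.
Variables (R : realType) (n : nat) (Q : R -> 'M[R]_n) (dQ : 'M[R]_n) (t : R).
Hypotheses (oQ : forall s, orthogonal_mx (Q s)) (hQ : is_derive t 1 Q dQ).

(** Differentiate [Q^T Q = 1]. *)
Lemma orthogonal_derive_skew : ((Q t)^T *m dQ)^T = - ((Q t)^T *m dQ).
Proof.
have h := is_derive_mulmx (is_derive_trmx hQ) hQ.
have h0 : is_derive t 1 (fun s => (Q s)^T *m Q s) 0.
  have -> : (fun s => (Q s)^T *m Q s) = cst 1%:M by apply/funext => s; exact: oQ.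
  exact: is_derive_cst.
have : dQ^T *m Q t + (Q t)^T *m dQ = 0.
  by rewrite -(@derive_val _ _ _ _ _ _ _ h) (@derive_val _ _ _ _ _ _ _ h0).
by rewrite trmx_mul trmxK => /eqP; rewrite addr_eq0 => /eqP.
Qed.

End SkewFromOrthogonal.

Lemma skew_part_unique (R : realType) (n : nat) (X A V : 'M[R]_n) :
  X^T = - X -> is_trig_mx V^T -> X = A - V -> X = skew_part A.
Proof.
move=> sX /is_trig_mxP tV eX.
have low (i j : 'I_n) : (j < i)%N -> X i j = A i j.
  by move=> ji; rewrite eX !mxE; have := tV j i ji; rewrite mxE => ->; rewrite subr0.
have skew i j : X i j = - X j i.
  by have /matrixP/(_ j i) := sX; rewrite !mxE.
apply/matrixP => i j; rewrite mxE.
case: (ltngtP i j) => [ij|ji|/val_inj ->]; last 1 first.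
- by have := skew j j => h; lra.
- by rewrite skew low.
- by rewrite low.
Qed.

Section Flow.
Variables (R : realType) (n : nat) (lam : 'I_n -> R) (pi : 'S_n) (g : R -> R).
Hypothesis lam_inj : injective lam.
Local Notation D := (diag_perm lam pi).
Local Notation E := (exp_diag (fun i => g (lam (pi i)))).

Lemma exp_diag_bidiagonal s (L : 'M[R]_n) : unit_lower L ->
  invmx (E s *m L *m E (- s)) *m D *m (E s *m L *m E (- s)) =
  E s *m (invmx L *m D *m L) *m E (- s).
Proof.
move=> hL; have uX := unit_lower_unit (unit_lower_conj (fun i => g (lam (pi i))) s hL).
rewrite -mulmxA; apply: (canLR (mulKmx uX)); rewrite !mulmxA.
rewrite -(mulmxA _ (E (- s)) (E s)) exp_diagVl mulmx1.
rewrite (mulmxK (unit_lower_unit hL)).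
by rewrite /diag_perm /exp_diag (diag_mxC (\row_i lam (pi i))).
Qed.

(** If [exp(tG) Q0 = Q U] is a QR factorization, with [G = g(Lambda)], then
    differentiating gives [Q^T Q' = Q^T G Q - U' U^-1]: the left side is skew,
    and [U' U^-1] is upper triangular. *)
Lemma QR_toda (Q0 : 'M[R]_n) (Q U : R -> 'M[R]_n) (t0 t : R) :
  (forall s, derivable Q s 1) -> (forall s, derivable U s 1) ->
  (forall s, orthogonal_mx (Q s)) -> (forall s, upper_posdiag (U s)) ->
  (forall s, E (s - t0) *m Q0 = Q s *m U s) ->
  is_derive t 1 (fun s => (Q s)^T *m D *m Q s)
    (toda_field g ((Q t)^T *m D *m Q t)).
Proof.
move=> dQ dU oQ hU eM.
have /derivableP hQ := dQ t; have /derivableP hU' := dU t.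
set Q' := 'D_1 Q t in hQ; set U' := 'D_1 U t in hU'.
pose G := diag_mx (\row_i g (lam (pi i))).
have oV := orthogonal_mxV (oQ t); have uU := upper_posdiag_unit (hU t).
have eD : Q' *m U t + Q t *m U' = G *m (Q t *m U t).
  have h1 := is_derive_mulmx hQ hU'.
  have h2 := is_derive_mulmx (is_derive_exp_diag (fun i => g (lam (pi i))) t0 t)
    (is_derive_cst Q0 t 1).
  rewrite -(@derive_val _ _ _ _ _ _ _ h1) -eM mulmxA.
  have -> : (fun s => Q s *m U s) = (fun s => E (s - t0) *m cst Q0 s).
    by apply/funext => s; rewrite eM.
  by rewrite (@derive_val _ _ _ _ _ _ _ h2) mulmx0 addr0.
have eX : (Q t)^T *m Q' = (Q t)^T *m G *m Q t - U' *m invmx (U t).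
  have := congr1 (fun X => (Q t)^T *m X *m invmx (U t)) eD.
  rewrite /= mulmxDr mulmxDl !mulmxA (oQ t) mul1mx !(mulmxK uU) => <-.
  by rewrite addrK.
have tV : is_trig_mx (U' *m invmx (U t))^T.
  rewrite trmx_mul trig_mulmx //; first by case: (upper_posdiagV (hU t)).
  apply/is_trig_mxP => i j ij; rewrite mxE.
  have /is_derive_mxP/(_ j i) h := hU'.
  rewrite -(@derive_val _ _ _ _ _ _ _ h).
  have -> : (fun s => U s j i) = cst 0; last exact: derive_cst.
  apply/funext => s; have [/is_trig_mxP/(_ i j ij) + _] := hU s.
  by rewrite mxE.
have gT : fun_calculus g ((Q t)^T *m D *m Q t) = (Q t)^T *m G *m Q t.
  rewrite (fun_calculusE g (oQ t) (erefl _)); congr (_ *m diag_mx _ *m _).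
  by apply/rowP => i; rewrite !mxE.
have sX := orthogonal_derive_skew oQ hQ.
have {}eX := skew_part_unique sX tV eX.
have h := is_derive_mulmx (is_derive_mulmx (is_derive_trmx hQ)
  (is_derive_cst D t 1)) hQ.
apply: is_derive_eq h _; rewrite /toda_field /mx_bracket mulmx0 addr0.
rewrite addrC; congr (_ + _).
  by rewrite gT -eX !mulmxA -(mulmxA _ (Q t)) oV mulmx1.
rewrite gT -eX -[RHS]mulNmx -sX trmx_mul trmxK /cst.
by rewrite !mulmxA -(mulmxA _ (Q t) (Q t)^T) oV mulmx1.
Qed.

(** With [Q0 = L0 U0], the factor [exp(tG) Q0] equals
    [(exp(tG) L0 exp(-tG)) (exp(tG) U0)], so the orthogonal factor stays
    LU-positive and its lower factor is known in closed form, although the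
    orthogonal factor itself is not. *)
Lemma toda_flow (T0 : 'M[R]_n) (t0 : R) : chart_domain lam pi T0 ->
  exists S : R -> 'M[R]_n,
    [/\ toda_solution lam g setT S, S t0 = T0,
        forall t, chart_domain lam pi (S t)
      & forall t, chart_L lam pi (S t)
                  = E (t - t0) *m chart_L lam pi T0 *m E (- (t - t0))].
Proof.
move=> c0; have [U0 [hL0 hU0]] := chart_domain_LU lam_inj c0.
set L0 := chart_L lam pi T0 in hL0 *.
have [Q0 eQ0] : exists Q0, Q0 = L0 *m U0 by exists (L0 *m U0).
rewrite -eQ0 => o0 e0.
have dM t : derivable (fun s => E (s - t0) *m Q0) t 1.
  by apply: derivable_mulmx => //; case: (is_derive_exp_diag (fun i => g (lam (pi i))) t0 t).
have kM t (v : 'cV[R]_n) : E (t - t0) *m Q0 *m v = 0 -> v = 0.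
  move/(congr1 (fun w => Q0^T *m (E (- (t - t0)) *m w))).
  by rewrite !mulmxA -(mulmxA Q0^T) exp_diagVl mulmx1 o0 mul1mx mulmx0.
have [Q [U [dQ dU oQ hU eM]]] := QR_derivable dM kM.
pose L t := E (t - t0) *m L0 *m E (- (t - t0)).
pose V t := E (t - t0) *m U0 *m invmx (U t).
have hL t : unit_lower (L t) by apply: unit_lower_conj.
have hV t : upper_posdiag (V t).
  apply: upper_posdiagM; last exact: upper_posdiagV.
  by apply: upper_posdiag_scale => // i; rewrite mxE expR_gt0.
have QE t : Q t = L t *m V t.
  rewrite -[LHS](mulmxK (upper_posdiag_unit (hU t))) -eM /L /V eQ0.
  by rewrite !mulmxA -(mulmxA _ (E _) (E _)) exp_diagVl mulmx1.
pose S t := (Q t)^T *m D *m Q t.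
have cL t : chart_L lam pi (S t) = L t.
  by apply: (chart_LE lam_inj (hL t) (hV t)); rewrite -QE //; exact: oQ.
have iT : isospectral lam T0 by case: c0.
have hS t : upper_hessenberg (S t).
  have oLV : orthogonal_mx (L t *m V t) by rewrite -QE; exact: oQ.
  rewrite /S QE; apply/(bidiagonal_hessenberg _ _ (hL t) (hV t) oLV).
  have h0 : upper_hessenberg (invmx L0 *m D *m L0).
    have o0' := o0; rewrite eQ0 in o0'.
    apply/(bidiagonal_hessenberg _ _ hL0 hU0 o0'); rewrite -eQ0.
    by rewrite -e0; apply: isospectral_hessenberg iT.
  have -> : invmx (L t) *m D *m L t =
      E (t - t0) *m (invmx L0 *m D *m L0) *m E (- (t - t0)).
    exact: exp_diag_bidiagonal.
  by move=> i j ij; rewrite exp_diag_conjE h0 ?mulr0.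
have iS t : isospectral lam (S t).
  have eS : S t = (Q0^T *m Q t)^T *m T0 *m (Q0^T *m Q t).
    rewrite /S [in RHS]e0 trmx_mul trmxK !mulmxA.
    rewrite -(mulmxA _ Q0 Q0^T) (orthogonal_mxV o0) mulmx1.
    by rewrite -(mulmxA _ Q0 Q0^T) (orthogonal_mxV o0) mulmx1.
  rewrite eS; apply: isospectral_conj => //.
    rewrite /orthogonal_mx trmx_mul trmxK -mulmxA (mulmxA Q0).
    by rewrite (orthogonal_mxV o0) mul1mx; exact: oQ.
  rewrite -eS; apply: tridiagonal_sym => //.
  by rewrite /S !trmx_mul trmxK tr_diag_mx mulmxA.
exists S; split=> // [t _||t].
- by split=> //; apply: (QR_toda t dQ dU oQ hU eM).
- have Q0E : Q0 = Q t0 *m U t0 by rewrite -eM subrr exp_diag0 mul1mx.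
  have UE : U t0 = (Q t0)^T *m Q0 by rewrite Q0E mulmxA oQ mul1mx.
  have U1 : U t0 = 1%:M.
    apply: orthogonal_upper_posdiag => //.
    rewrite /orthogonal_mx UE trmx_mul trmxK -mulmxA (mulmxA (Q t0)).
    by rewrite (orthogonal_mxV (oQ t0)) mul1mx.
  by rewrite [RHS]e0 Q0E U1 mulmx1.
- split=> //; exists (Q t); split=> //.
  by exists (L t), (V t); apply/LU_factorsE.
Qed.

Lemma bidiag_coord_flow (T0 T : 'M[R]_n) (s : R) k : chart_domain lam pi T0 ->
  chart_L lam pi T = E s *m chart_L lam pi T0 *m E (- s) ->
  bidiag_coord lam pi T k = bidiag_coord lam pi T0 k
  * expR ((g (lam (pi (ord_next k))) - g (lam (pi (ord_this k)))) * s).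
Proof.
move=> /(chart_domain_LU lam_inj)[_ [hL _ _ _]] eL.
rewrite /bidiag_coord /chart_B -!/(chart_L _ _ _) eL exp_diag_bidiagonal //.
by rewrite exp_diag_conjE mulrC.
Qed.

End Flow.

(** * Uniqueness of solutions *)

Section Gronwall.
Variable R : realType.
Implicit Types (f df : R -> R) (J : set R).

(** Gronwall: [f exp(-K (s - t0))] is nonincreasing, which forces [f <= 0] to the
    right of [t0]; [f exp(K (s - t0))] is nondecreasing, which does it to the
    left. *)
Lemma derive_bound_vanish f df J (K t0 : R) :
  is_interval J -> (forall t, J t -> is_derive t 1 f (df t)) ->
  (forall t, J t -> 0 <= f t) -> (forall t, J t -> `|df t| <= K * f t) ->
  J t0 -> f t0 = 0 -> forall t, J t -> f t = 0.
Proof.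
move=> iJ hf f_ge0 bf J0 f0 t Jt.
pose h (c s : R) := f s * expR (c * (s - t0)).
pose dh (c s : R) := (df s + c * f s) * expR (c * (s - t0)).
have hh c s : J s -> is_derive s 1 (h c) (dh c s).
  by move=> Js; apply: is_derive_mul_expR; exact: hf.
have mvt c a b : J a -> J b -> a <= b ->
    exists2 x, J x & h c b - h c a = dh c x * (b - a).
  move=> Ja Jb ab.
  have Jab (x : R) : x \in `[a, b]%R -> J x by rewrite in_itv /=; apply: iJ.
  have dab x : x \in `]a, b[%R -> is_derive x 1 (h c) (dh c x).
    by rewrite in_itv /= => /andP[ax xb]; apply/hh/Jab; rewrite in_itv /= !ltW.
  have cab : {within `[a, b], continuous (h c)}.
    by apply: derivable_within_continuous => x /Jab Jx; case: (hh c x Jx).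
  by have [x /Jab Jx e] := MVT_segment ab dab cab; exists x.
have h0 c : h c t0 = 0 by rewrite /h f0 mul0r.
suff : f t <= 0 by move=> ft; apply/eqP; rewrite eq_le ft f_ge0.
have hle c : h c t <= 0 -> f t <= 0 by rewrite /h pmulr_lle0 // expR_gt0.
case: (leP t0 t) => [le0t|/ltW let0].
  apply: (hle (- K)); have [x Jx e] := mvt (- K) t0 t J0 Jt le0t.
  move: e; rewrite h0 subr0 => ->; rewrite mulr_le0_ge0 ?subr_ge0 //.
  rewrite /dh mulr_le0_ge0 ?expR_ge0 // mulNr subr_le0.
  exact: le_trans (ler_norm _) (bf x Jx).
apply: (hle K); have [x Jx e] := mvt K t t0 Jt J0 let0.
move: e; rewrite h0 sub0r => e; rewrite -oppr_ge0 e mulr_ge0 ?subr_ge0 //.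
rewrite /dh mulr_ge0 ?expR_ge0 // -lerBlDl sub0r.
by have := bf x Jx; rewrite ler_norml lerNl => /andP[].
Qed.

Lemma linear_ode_unique f J (c t0 : R) :
  is_interval J -> (forall t, J t -> is_derive t 1 f (c * f t)) ->
  J t0 -> forall t, J t -> f t = f t0 * expR (c * (t - t0)).
Proof.
move=> iJ hf J0 t Jt.
pose e (s : R) := f t0 * expR (c * (s - t0)).
have he (s : R) : is_derive s 1 e (c * e s).
  have h := is_derive_mul_expR c t0 (is_derive_cst (f t0) s 1).
  by apply: is_derive_eq h _; rewrite add0r mulrA.
pose d s := f s - e s.
have hd s : J s -> is_derive s 1 d (c * d s).
  move=> Js; apply: is_derive_eq (is_deriveB (hf s Js) (he s)) _.
  by rewrite /d mulrBr.
pose k := 2 * `|c|.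
suff : d t * d t = 0.
  by move/eqP; rewrite mulf_eq0 orbb subr_eq0 => /eqP.
apply: (@derive_bound_vanish (fun s => d s * d s)
  (fun s => (c * d s) * d s + d s * (c * d s)) J k t0) => //.
- by move=> s Js; apply: is_derive_mulE; exact: hd.
- by move=> s _; rewrite -expr2 sqr_ge0.
- move=> s _; have -> : c * d s * d s + d s * (c * d s) = 2 * c * (d s * d s).
    by ring.
  by rewrite !normrM (ger0_norm (ler0n _ 2)) -normrM -expr2 normrX real_normK ?num_real.
- by rewrite /d /e subrr mulr0 expR0 mulr1 subrr mulr0.
Qed.

End Gronwall.

Section MatrixNorm.
Variables (R : realType).

Lemma norm_sum_le (n : nat) (F : 'I_n -> R) (c : R) :
  (forall i, `|F i| <= c) -> `|\sum_i F i| <= n%:R * c.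
Proof.
move=> h; rewrite (le_trans (ler_norm_sum _ _ _)) // mulr_natl.
by rewrite -[X in _ *+ X]card_ord -sumr_const ler_sum.
Qed.

Lemma mx_norm_leP (m n : nat) (A : 'M[R]_(m, n)) (c : R) : 0 <= c ->
  `|A| <= c <-> forall i j, `|A i j| <= c.
Proof.
move=> c0; rewrite /Num.Def.normr /= mx_normrE; split=> [h i j|h].
  by apply: le_trans h; exact: (le_bigmax _ (fun k => `|A k.1 k.2|) (i, j)).
by apply: bigmax_le => // -[i j] _; exact: h.
Qed.

Lemma mx_norm_entry (m n : nat) (A : 'M[R]_(m, n)) i j : `|A i j| <= `|A|.
Proof. exact: (mx_norm_leP A (normr_ge0 A)).1. Qed.

Lemma mx_norm_mul (m n p : nat) (A : 'M[R]_(m, n)) (B : 'M[R]_(n, p)) :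
  `|A *m B| <= n%:R * (`|A| * `|B|).
Proof.
apply/mx_norm_leP => [|i j]; first by rewrite !mulr_ge0.
rewrite mxE norm_sum_le // => k; by rewrite normrM ler_pM // mx_norm_entry.
Qed.

Lemma mx_norm_skew_part (n : nat) (A : 'M[R]_n) : `|skew_part A| <= `|A|.
Proof.
apply/mx_norm_leP => // i j; rewrite mxE.
by do 2?case: ifP => _; rewrite ?normrN ?normr0 ?mx_norm_entry.
Qed.

Lemma mx_norm_orthogonal (n : nat) (Q : 'M[R]_n) : orthogonal_mx Q -> `|Q| <= 1.
Proof.
move=> oQ; apply/mx_norm_leP => // i j.
rewrite -(@ler_pXn2r _ 2) ?nnegrE // expr1n real_normK ?num_real //.
have /matrixP/(_ j j) := oQ; rewrite !mxE eqxx mulr1n => <-.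
rewrite (bigD1 i) //= mxE -expr2 lerDl sumr_ge0 // => k _.
by rewrite mxE -expr2 sqr_ge0.
Qed.

Variable n : nat.
Implicit Types (S : set 'M[R]_n) (F G : 'M[R]_n -> 'M[R]_n).

(** The boundedness clause is what makes this class stable under products. *)
Definition bounded_lipschitz S F : Prop :=
  exists K : R, forall X Y, S X -> S Y -> `|F X| <= K /\ `|F X - F Y| <= K * `|X - Y|.

Lemma bounded_lipschitzD S F G : bounded_lipschitz S F -> bounded_lipschitz S G ->
  bounded_lipschitz S (fun X => F X + G X).
Proof.
move=> [K hF] [K' hG]; exists (K + K') => X Y SX SY.
have [f1 f2] := hF X Y SX SY; have [g1 g2] := hG X Y SX SY; split.
  by rewrite (le_trans (ler_normD _ _)) // lerD.
by rewrite opprD addrACA mulrDl (le_trans (ler_normD _ _)) // lerD.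
Qed.

Lemma bounded_lipschitzN S F : bounded_lipschitz S F ->
  bounded_lipschitz S (fun X => - F X).
Proof.
move=> [K hF]; exists K => X Y SX SY; have [f1 f2] := hF X Y SX SY.
by rewrite -opprD !normrN.
Qed.

Lemma bounded_lipschitzM S F G : bounded_lipschitz S F -> bounded_lipschitz S G ->
  bounded_lipschitz S (fun X => F X *m G X).
Proof.
move=> [K hF] [K' hG]; exists (n%:R * (2 * (K * K'))) => X Y SX SY.
have [f1 f2] := hF X Y SX SY; have [g1 g2] := hG X Y SX SY.
have [_ f2'] := hF Y X SY SX; have [g1' _] := hG Y X SY SX.
have K0 : 0 <= K := le_trans (normr_ge0 _) f1.
have K0' : 0 <= K' := le_trans (normr_ge0 _) g1.
have KK : 0 <= K * K' by rewrite mulr_ge0.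
split.
  rewrite (le_trans (mx_norm_mul _ _)) // ler_wpM2l //.
  by apply: (@le_trans _ _ (K * K')); [apply: ler_pM|rewrite ler_peMl ?ler1n].
have -> : F X *m G X - F Y *m G Y = F X *m (G X - G Y) + (F X - F Y) *m G Y.
  by rewrite mulmxBr mulmxBl addrA subrK.
have -> : n%:R * (2 * (K * K')) * `|X - Y| =
    n%:R * (K * (K' * `|X - Y|)) + n%:R * (K * `|X - Y| * K') by ring.
rewrite (le_trans (ler_normD _ _)) // lerD // (le_trans (mx_norm_mul _ _)) //.
  by rewrite ler_wpM2l // ler_pM.
by rewrite ler_wpM2l // ler_pM.
Qed.

Lemma bounded_lipschitz_cst S A : bounded_lipschitz S (fun=> A).
Proof.
exists `|A| => X Y _ _; rewrite lexx subrr normr0; split=> //.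
Qed.

Lemma bounded_lipschitz_id S (c : R) : (forall X, S X -> `|X| <= c) ->
  bounded_lipschitz S id.
Proof.
move=> hS; exists (Num.max c 1) => X Y SX SY; split.
  by rewrite le_max hS.
by rewrite ler_peMl // le_max lexx orbT.
Qed.

Lemma bounded_lipschitz_skew_part S F : bounded_lipschitz S F ->
  bounded_lipschitz S (fun X => skew_part (F X)).
Proof.
move=> [K hF]; exists K => X Y SX SY; have [f1 f2] := hF X Y SX SY; split.
  exact: le_trans (mx_norm_skew_part _) f1.
have -> : skew_part (F X) - skew_part (F Y) = skew_part (F X - F Y).
  apply/matrixP => i j; rewrite !mxE.
  case: (j < i)%N => //; case: (i < j)%N; last by rewrite subrr.
  by rewrite opprB opprK addrC.
exact: le_trans (mx_norm_skew_part _) f2.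
Qed.

End MatrixNorm.

Lemma bounded_lipschitz_horner (R : realType) (n : nat) (S : set 'M[R]_n.+1)
    (c : R) (p : {poly R}) :
  (forall X, S X -> `|X| <= c) -> bounded_lipschitz S (fun X => horner_mx X p).
Proof.
move=> hS; elim/poly_ind: p => [|p a IH].
  have -> : (fun X : 'M[R]_n.+1 => horner_mx X 0) = fun=> 0.
    by apply/funext => X; rewrite rmorph0.
  exact: bounded_lipschitz_cst.
have -> : (fun X : 'M[R]_n.+1 => horner_mx X (p * 'X + a%:P)) =
    fun X => horner_mx X p *m X + a%:M.
  by apply/funext => X; rewrite rmorphD rmorphM /= horner_mx_X horner_mx_C.
apply: bounded_lipschitzD; last exact: bounded_lipschitz_cst.
apply: bounded_lipschitzM => //; exact: bounded_lipschitz_id hS.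
Qed.

Section Uniqueness.
Variables (R : realType) (n : nat) (lam : 'I_n -> R) (g : R -> R).
Hypothesis lam_inj : injective lam.

(** Isospectral matrices are orthogonal conjugates of [Lambda]. *)
Lemma isospectral_bounded :
  exists c : R, forall T, isospectral lam T -> `|T| <= c.
Proof.
pose D := diag_mx (\row_i lam i).
exists (n%:R * (n%:R * (`|D|))) => T /(isospectral_diag lam_inj)[Q oQ ->].
have q1 := mx_norm_orthogonal oQ.
have q2 : `|Q^T| <= 1.
  by apply: mx_norm_orthogonal; rewrite /orthogonal_mx trmxK; exact: orthogonal_mxV.
rewrite (le_trans (mx_norm_mul _ _)) // ler_wpM2l //.
rewrite (@le_trans _ _ (`|Q^T *m D| * 1)) ?ler_wpM2l // mulr1.
rewrite (le_trans (mx_norm_mul _ _)) // ler_wpM2l //.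
by rewrite ler_piMl.
Qed.

(** On the isospectral set [g(T)] is a polynomial in [T], by interpolation. *)
Lemma toda_field_lipschitz :
  exists K : R, forall X Y, isospectral lam X -> isospectral lam Y ->
    `|toda_field g X - toda_field g Y| <= K * `|X - Y|.
Proof.
have [c hc] := isospectral_bounded; have [p hp] := interpolation lam_inj (g \o lam).
case: n lam lam_inj hc hp => [|n'] lam' linj hc hp.
  by exists 0 => X Y _ _; rewrite (_ : _ - _ = 0) ?normr0 ?mul0r //; apply/matrixP => -[].
have hs := bounded_lipschitz_skew_part (bounded_lipschitz_horner p hc).
have hi := bounded_lipschitz_id hc.
have [K hK] := bounded_lipschitzD (bounded_lipschitzM hi hs)
  (bounded_lipschitzN (bounded_lipschitzM hs hi)).
exists K => X Y sX sY; have [_] := hK X Y sX sY.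
by rewrite /toda_field /mx_bracket !(fun_calculus_horner linj hp).
Qed.

(** Gronwall applied to the squared Frobenius distance of the two solutions. *)
Lemma toda_unique (J : set R) (T S : R -> 'M[R]_n) (t0 : R) :
  is_interval J -> toda_solution lam g J T -> toda_solution lam g J S ->
  J t0 -> T t0 = S t0 -> forall t, J t -> T t = S t.
Proof.
move=> iJ hT hS J0 e0; have [K hK] := toda_field_lipschitz.
pose d t := T t - S t; pose dd t := toda_field g (T t) - toda_field g (S t).
have hd t : J t -> is_derive t 1 d (dd t).
  by move=> Jt; apply: is_deriveB; [case: (hT t Jt)|case: (hS t Jt)].
pose f t := \sum_i \sum_j d t i j * d t i j.
pose df t := \sum_i \sum_j (dd t i j * d t i j + d t i j * dd t i j).
have f_ge0 t : 0 <= f t.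
  by apply: sumr_ge0 => i _; apply: sumr_ge0 => j _; rewrite -expr2 sqr_ge0.
have d2_le i j t : d t i j ^+ 2 <= f t.
  rewrite /f (bigD1 i) //= (bigD1 j) //= -expr2 -addrA lerDl addr_ge0 //.
    by apply: sumr_ge0 => k _; rewrite -expr2 sqr_ge0.
  by apply: sumr_ge0 => k _; apply: sumr_ge0 => l _; rewrite -expr2 sqr_ge0.
have d_le t : `|d t| ^+ 2 <= f t.
  rewrite -[leRHS]sqr_sqrtr // ler_pXn2r ?nnegrE ?sqrtr_ge0 //.
  apply/mx_norm_leP; first exact: sqrtr_ge0.
  by move=> i j; rewrite -sqrtr_sqr ler_wsqrtr.
suff f0 t : J t -> f t = 0.
  move=> t Jt; apply/eqP; rewrite -subr_eq0 -normr_le0.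
  have := d_le t; rewrite f0 // => h.
  by rewrite -[leLHS]ger0_norm // normr_le0 -sqrf_eq0 eq_le h sqr_ge0.
apply: (@derive_bound_vanish _ f df J (n%:R * (n%:R * (`|K| + `|K|))) t0) => //.
- move=> s Js; apply: is_derive_sumE => i; apply: is_derive_sumE => j.
  have /is_derive_mxP h := hd s Js.
  by apply: is_derive_mulE.
- move=> s Js; rewrite /df -2!mulrA.
  apply: norm_sum_le => i; apply: norm_sum_le => j.
  have dd_le : `|dd s i j| <= `|K| * `|d s|.
    apply: le_trans (mx_norm_entry _ _ _) _.
    have [hT1 _] := hT s Js; have [hS1 _] := hS s Js.
    by apply: le_trans (hK _ _ hT1 hS1) _; rewrite ler_wpM2r // ler_norm.
  have d_le1 := mx_norm_entry (d s) i j.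
  have H : `|dd s i j * d s i j| <= `|K| * f s.
    rewrite normrM; apply: (@le_trans _ _ (`|K| * `|d s| * `|d s|)).
      by apply: ler_pM.
    by rewrite -mulrA -expr2 ler_wpM2l.
  rewrite (le_trans (ler_normD _ _)) // mulrDl lerD //.
  by rewrite mulrC.
- by rewrite /f big1 // => i _; rewrite big1 // => j _; rewrite /d e0 subrr mxE mulr0.
Qed.

End Uniqueness.

(** * Limits *)

Lemma cvg_eq_lim (I : Type) (F : set_system I) (V : topologicalType) (f : I -> V)
    (a b : V) : f @ F --> b -> b = a -> f @ F --> a.
Proof. by move=> h <-. Qed.

Section CvgMatrix.
Variables (R : realType) (I : Type) (F : set_system I).
Context {FF : Filter F}.

Lemma cvg_mxP (m n : nat) (M : I -> 'M[R]_(m, n)) (A : 'M[R]_(m, n)) :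
  M @ F --> A <-> forall i j, M t i j @[t --> F] --> A i j.
Proof.
split=> [h i j|h].
  apply/cvgrPdist_le => e e0; move/cvgrPdist_le : h => /(_ e e0).
  apply: filterS => t /=; apply: le_trans.
  by have := mx_norm_entry (A - M t) i j; rewrite !mxE.
apply/cvgrPdist_le => e e0.
have : \forall t \near F, forall k : 'I_m * 'I_n, `|A k.1 k.2 - M t k.1 k.2| <= e.
  apply: filter_forall => k; move/cvgrPdist_le : (h k.1 k.2); exact.
apply: filterS => t /= ht; apply/mx_norm_leP; first exact: ltW.
by move=> i j; have := ht (i, j); rewrite !mxE.
Qed.

Lemma cvg_sumr (J : Type) (r : seq J) (P : pred J) (f : J -> I -> R) (a : J -> R) :
  (forall j, P j -> f j @ F --> a j) ->
  (\sum_(j <- r | P j) f j t) @[t --> F] --> \sum_(j <- r | P j) a j.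
Proof. by move=> h; apply: cvg_big => // x; exact: add_continuous. Qed.

Lemma cvg_mulmx (m n p : nat) (M : I -> 'M[R]_(m, n)) (N : I -> 'M[R]_(n, p))
    (A : 'M[R]_(m, n)) (B : 'M[R]_(n, p)) :
  M @ F --> A -> N @ F --> B -> (M t *m N t) @[t --> F] --> A *m B.
Proof.
move=> /cvg_mxP hM /cvg_mxP hN; apply/cvg_mxP => i j.
under eq_cvg do rewrite mxE; rewrite mxE.
by apply: cvg_sumr => k _; apply: cvgM.
Qed.

Lemma cvg_trmx (m n : nat) (M : I -> 'M[R]_(m, n)) (A : 'M[R]_(m, n)) :
  M @ F --> A -> (M t)^T @[t --> F] --> A^T.
Proof.
move=> /cvg_mxP hM; apply/cvg_mxP => i j.
by under eq_cvg do rewrite mxE; rewrite mxE; exact: hM.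
Qed.

(** Continuity at the identity of the Cholesky factor, row by row: once the
    rows above [i] are known to converge, the identity
    [U_ii U_ij = (U^T U)_ij - sum_(k < i) U_ki U_kj] gives the limit of [U_ii]
    (take [j = i] and use positivity) and then of the whole row. *)
Lemma upper_posdiag_gram_cvg1 (n : nat) (U : I -> 'M[R]_n) :
  (forall t, upper_posdiag (U t)) ->
  ((U t)^T *m U t) @[t --> F] --> (1%:M : 'M[R]_n) ->
  U @ F --> (1%:M : 'M[R]_n).
Proof.
move=> hU /cvg_mxP hG; apply/cvg_mxP.
suff H m : forall i : 'I_n, (i < m)%N ->
    forall j, U t i j @[t --> F] --> (1%:M : 'M[R]_n) i j.
  by move=> i; apply: (H i.+1).
elim: m => // m IH i; rewrite ltnS => im.
have prodE t j : U t i i * U t i j =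
    ((U t)^T *m U t) i j - \sum_(k < n | (k < i)%N) U t k i * U t k j.
  rewrite mxE (bigID (fun k : 'I_n => (k < i)%N)) /= addrAC.
  under [X in X - _]eq_bigr do rewrite mxE.
  rewrite subrr add0r (bigD1 i) ?ltnn //= mxE big1 ?addr0 // => k.
  rewrite -leqNgt => /andP[ik ki].
  have [/is_trig_mxP/(_ i k) + _] := hU t; rewrite mxE => ->; first by rewrite mul0r.
  by rewrite ltn_neqAle ik andbT eq_sym.
have hprod j : U t i i * U t i j @[t --> F] --> (1%:M : 'M[R]_n) i j.
  under eq_cvg do rewrite prodE.
  have hs : (\sum_(k < n | (k < i)%N) U t k i * U t k j) @[t --> F] -->
      \sum_(k < n | (k < i)%N) (1%:M : 'M[R]_n) k i * (1%:M : 'M[R]_n) k j.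
    apply: cvg_sumr => k ki.
    by apply: cvgM; apply: IH; apply: leq_trans ki im.
  apply: (cvg_eq_lim (cvgB (hG i j) hs)).
  rewrite big1 ?subr0 // => k ki; rewrite [X in X * _]mxE.
  have -> : (k == i) = false by apply/eqP => e; rewrite e ltnn in ki.
  by rewrite mul0r.
have hii : U t i i @[t --> F] --> (1 : R).
  have -> : (fun t => U t i i) = (fun t => Num.sqrt (U t i i * U t i i)).
    by apply/funext => t; rewrite -expr2 sqrtr_sqr ger0_norm // ltW //; case: (hU t).
  have h1 := hprod i; rewrite mxE eqxx mulr1n in h1.
  apply: (cvg_eq_lim _ (sqrtr1 R)).
  by apply: continuous_cvg h1; exact: sqrt_continuous.
move=> j; have -> : (fun t => U t i j) = (fun t => (U t i i)^-1 * (U t i i * U t i j)).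
  by apply/funext => t; rewrite mulKf // gt_eqF //; case: (hU t).
have hV : (U t i i)^-1 @[t --> F] --> (1 : R)^-1.
  by apply: cvgV => //; exact: oner_neq0.
by apply: (cvg_eq_lim (cvgM hV (hprod j))); rewrite invr1 mul1r.
Qed.

(** The factor [U] converges because [U^T U = L^T L]; then so does
    [Q^T = U - Q^T (L - 1)], orthogonal matrices being bounded. *)
Lemma QR_cvg1 (n : nat) (L Q U : I -> 'M[R]_n) :
  (forall t, orthogonal_mx (Q t)) -> (forall t, upper_posdiag (U t)) ->
  (forall t, L t = Q t *m U t) -> L @ F --> (1%:M : 'M[R]_n) ->
  U @ F --> (1%:M : 'M[R]_n) /\ Q @ F --> (1%:M : 'M[R]_n).
Proof.
move=> oQ hU eL hL.
have hU1 : U @ F --> (1%:M : 'M[R]_n).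
  apply: upper_posdiag_gram_cvg1 => //.
  have -> : (fun t => (U t)^T *m U t) = (fun t => (L t)^T *m L t).
    apply/funext => t; rewrite eL trmx_mul -mulmxA (mulmxA (Q t)^T).
    by rewrite (oQ t) mul1mx.
  by apply: (cvg_eq_lim (cvg_mulmx (cvg_trmx hL) hL)); rewrite trmx1 mulmx1.
split=> //.
have hL0 : (L t - 1%:M) @[t --> F] --> (0 : 'M[R]_n).
  by apply: (cvg_eq_lim (cvgB hL (cvg_cst (1%:M : 'M[R]_n)))); rewrite subrr.
have hE : ((Q t)^T *m (L t - 1%:M)) @[t --> F] --> (0 : 'M[R]_n).
  apply/cvgr0Pnorm_le => e e0.
  have e' : 0 < e / n.+1%:R by rewrite divr_gt0.
  move/cvgr0Pnorm_le : hL0 => /(_ _ e'); apply: filterS => t ht.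
  have q1 : `|(Q t)^T| <= 1.
    by apply: mx_norm_orthogonal; rewrite /orthogonal_mx trmxK; exact: orthogonal_mxV.
  apply: le_trans (mx_norm_mul _ _) _.
  apply: (@le_trans _ _ (n.+1%:R * (e / n.+1%:R))); last first.
    by rewrite mulrC divfK // pnatr_eq0.
  apply: ler_pM; rewrite ?mulr_ge0 ?ler_nat //.
  by apply: le_trans ht; rewrite ler_piMl.
have -> : Q = fun t => (U t - (Q t)^T *m (L t - 1%:M))^T.
  apply/funext => t; rewrite mulmxBr mulmx1 eL mulmxA (oQ t) mul1mx subKr.
  by rewrite trmxK.
by apply: (cvg_eq_lim (cvg_trmx (cvgB hU1 hE))); rewrite subr0 trmx1.
Qed.

End CvgMatrix.

Lemma expR_neg_cvg0 (R : realType) (a b : R) : a < 0 ->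
  expR (a * t) * b @[t --> +oo] --> (0 : R).
Proof.
move=> a0; apply: (cvg_eq_lim _ (mul0r b)); apply: cvgM; last exact: cvg_cst.
have h : - a * t @[t --> +oo] --> +oo.
  by apply: gt0_cvgMry; [rewrite oppr_gt0|exact: cvg_id].
have -> : (fun t => expR (a * t)) = (fun t => expR (- t)) \o (fun t => - a * t).
  by apply/funext => t /=; rewrite mulNr opprK.
exact: cvg_comp h (@cvgr_expR R).
Qed.

Lemma upper_hessenberg_mull_sub (R : realType) (n : nat) (U A : 'M[R]_n) k :
  is_trig_mx U^T -> upper_hessenberg A ->
  (U *m A) (ord_next k) (ord_this k)
  = U (ord_next k) (ord_next k) * A (ord_next k) (ord_this k).
Proof.
move=> /is_trig_mxP hU hA; rewrite mxE (bigD1 (ord_next k)) //= big1 ?addr0 // => l.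
move=> lk; case: (ltngtP l (ord_next k)) => [h|h|/val_inj h].
- by have := hU l _ h; rewrite mxE => ->; rewrite mul0r.
- by rewrite hA ?mulr0.
- by rewrite h eqxx in lk.
Qed.

Lemma upper_hessenberg_mulr_sub (R : realType) (n : nat) (U A : 'M[R]_n) k :
  is_trig_mx U^T -> upper_hessenberg A ->
  (A *m U) (ord_next k) (ord_this k)
  = A (ord_next k) (ord_this k) * U (ord_this k) (ord_this k).
Proof.
move=> /is_trig_mxP hU hA; rewrite mxE (bigD1 (ord_this k)) //= big1 ?addr0 // => l.
move=> lk; case: (ltngtP l (ord_this k)) => [h|h|/val_inj h].
- by rewrite hA ?mul0r.
- by have := hU (ord_this k) _ h; rewrite mxE => ->; rewrite mulr0.
- by rewrite h eqxx in lk.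
Qed.

Lemma ord_consecutive_decr (R : realType) (n : nat) (c : 'I_n -> R) :
  (forall k : 'I_n.-1, c (ord_next k) < c (ord_this k)) ->
  forall i j : 'I_n, (i < j)%N -> c j < c i.
Proof.
move=> h i [j lt_j] /=; elim: j lt_j => // j IH lt_j; rewrite ltnS => ij.
have hj : (j < n.-1)%N by rewrite -subn1 ltn_subRL add1n.
have lt_j' : (j < n)%N by apply: ltnW.
have step : c (Ordinal lt_j) < c (Ordinal lt_j').
  have := h (Ordinal hj).
  have -> : ord_next (Ordinal hj) = Ordinal lt_j by apply: val_inj.
  by have -> : ord_this (Ordinal hj) = Ordinal lt_j' by apply: val_inj.
move: ij; rewrite leq_eqVlt => /orP[/eqP ij|ij].
  by have -> : i = Ordinal lt_j' by apply: val_inj.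
exact: lt_trans step (IH lt_j' ij).
Qed.

(** Conjugation by [exp(t diag(c))] multiplies the entry [(i, j)] by
    [exp((c i - c j) t)], which decays below the diagonal when [c] decreases. *)
Lemma exp_diag_conj_cvg1 (R : realType) (n : nat) (c : 'I_n -> R) (L : 'M[R]_n) :
  (forall i j : 'I_n, (i < j)%N -> c j < c i) -> unit_lower L ->
  (exp_diag c t *m L *m exp_diag c (- t)) @[t --> +oo] --> (1%:M : 'M[R]_n).
Proof.
move=> hc [/is_trig_mxP tL dL]; apply/cvg_mxP => i j.
have -> : (fun t => (exp_diag c t *m L *m exp_diag c (- t)) i j) =
    (fun t => expR ((c i - c j) * t) * L i j).
  by apply/funext => t; rewrite exp_diag_conjE.
rewrite mxE; case: (ltngtP i j) => [ij|ji|/val_inj->].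
- have -> : (i == j) = false by apply/eqP => e; rewrite e ltnn in ij.
  have -> : (fun t => expR ((c i - c j) * t) * L i j) = fun=> 0.
    by apply/funext => t; rewrite tL // mulr0.
  exact: cvg_cst.
- have -> : (i == j) = false by apply/eqP => e; rewrite e ltnn in ji.
  by apply: expR_neg_cvg0; rewrite subr_lt0 hc.
- have -> : (fun t => expR ((c j - c j) * t) * L j j) = fun=> 1.
    by apply/funext => t; rewrite dL subrr mul0r expR0 mulr1.
  by rewrite eqxx; exact: cvg_cst.
Qed.

Section ChartLimit.
Variables (R : realType) (n : nat) (lam : 'I_n -> R) (pi : 'S_n).
Hypothesis lam_inj : injective lam.
Variables (I : Type) (F : set_system I).
Context {FF : Filter F}.

(** The off-diagonal entries and the coordinates agree up to ratios of diagonal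
    entries of the upper factor, which tends to the identity with [L]. *)
Lemma chart_L_cvg1 (T : I -> 'M[R]_n) :
  (forall t, chart_domain lam pi (T t)) ->
  chart_L lam pi (T t) @[t --> F] --> (1%:M : 'M[R]_n) ->
  T @ F --> diag_perm lam pi /\
  forall k, exists2 r : I -> R, r @ F --> (1 : R) &
    forall t, T t (ord_this k) (ord_next k) = bidiag_coord lam pi (T t) k * r t.
Proof.
move=> cT hL; pose L t := chart_L lam pi (T t).
have hV t := chart_domain_LU lam_inj (cT t).
pose V t := sval (cid (hV t)).
have VP t := svalP (cid (hV t)); rewrite -/(V _) -/(L _) in VP.
pose U t := invmx (V t).
have hU t : upper_posdiag (U t) by apply: upper_posdiagV; case: (VP t).
have oQ t : orthogonal_mx (L t *m V t) by case: (VP t).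
have LE t : L t = L t *m V t *m U t.
  by have [_ /upper_posdiag_unit uV _ _] := VP t; rewrite /U mulmxK.
have [hU1 hQ1] := QR_cvg1 oQ hU LE hL.
split.
  have TE : T = fun t => (L t *m V t)^T *m diag_perm lam pi *m (L t *m V t).
    by apply/funext => t; case: (VP t).
  have h := cvg_mulmx (cvg_mulmx (cvg_trmx hQ1) (cvg_cst (diag_perm lam pi))) hQ1.
  rewrite trmx1 mul1mx mulmx1 in h; rewrite TE; exact: h.
move=> k; exists (fun t => U t (ord_next k) (ord_next k) / U t (ord_this k) (ord_this k)).
  move/cvg_mxP : hU1 => hU1.
  have h1 := hU1 (ord_next k) (ord_next k); have h2 := hU1 (ord_this k) (ord_this k).
  rewrite !mxE !eqxx !mulr1n in h1 h2.
  have h3 : (U t (ord_this k) (ord_this k))^-1 @[t --> F] --> (1 : R)^-1.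
    by apply: cvgV => //; exact: oner_neq0.
  by apply: (cvg_eq_lim (cvgM h1 h3)); rewrite invr1 mulr1.
move=> t; have [hL1 hV1 _ eT] := VP t.
have [[sT _ _] _] := cT t; rewrite -{1}sT mxE.
have uV := upper_posdiag_unit hV1; have [tV dV] := hV1; have [tU _] := hU t.
have hT : upper_hessenberg (T t) by apply: (@isospectral_hessenberg _ _ lam); case: (cT t).
have hB := hT; rewrite eT in hB.
move/(bidiagonal_hessenberg _ _ hL1 hV1 (oQ t)) : hB => hB.
have eB := bidiagonal_intertwine lam pi hL1 (oQ t); rewrite -eT in eB.
have eT2 : T t = U t *m (invmx (L t) *m diag_perm lam pi *m L t *m V t).
  by rewrite -eB /U mulKmx.
rewrite [in LHS]eT2 upper_hessenberg_mull_sub //; last exact: upper_hessenberg_mulr.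
rewrite upper_hessenberg_mulr_sub //.
have -> : V t (ord_this k) (ord_this k) = (U t (ord_this k) (ord_this k))^-1.
  have -> : U t (ord_this k) (ord_this k) = invmx (V t)^T (ord_this k) (ord_this k).
    by rewrite -trmx_inv [RHS]mxE.
  rewrite trig_invmx_diag //; first by rewrite mxE invrK.
  exact: upper_posdiag_neq0.
rewrite /bidiag_coord /chart_B -/(chart_L lam pi (T t)) -/(L t).
by ring.
Qed.

End ChartLimit.

(** * The Toda flow in bidiagonal coordinates *)

Section LinearSystem.
Variables (R : realType) (n : nat) (lam : 'I_n -> R) (pi : 'S_n) (g : R -> R).
Hypothesis lam_inj : injective lam.
Local Notation c := (fun i => g (lam (pi i))).

Lemma near_eq_open (V : Type) (J : set R) (f h : R -> V) (t : R) :
  open J -> J t -> (forall s, J s -> f s = h s) -> \near t, f t = h t.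
Proof.
move=> oJ Jt fh; have := open_nbhs_nbhs (conj oJ Jt).
by apply: filterS => s /fh.
Qed.

(** Near [t], a solution coincides with the explicit flow started at [T t], whose
    coordinates are exponentials. *)
Lemma toda_solution_coord (J : set R) (T : R -> 'M[R]_n) :
  open J -> is_interval J -> (forall t, J t -> chart_domain lam pi (T t)) ->
  toda_solution lam g J T ->
  forall t, J t -> forall k : 'I_n.-1,
    is_derive t 1 (fun s => bidiag_coord lam pi (T s) k)
      ((c (ord_next k) - c (ord_this k)) * bidiag_coord lam pi (T t) k).
Proof.
move=> oJ iJ cT sT t Jt k.
have [S [sS S0 cS LS]] := toda_flow g lam_inj t (cT t Jt).
have sSJ : toda_solution lam g J S by move=> s _; exact: sS.
have TS := toda_unique lam_inj iJ sT sSJ Jt (esym S0).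
have bE s : J s -> bidiag_coord lam pi (T t) k
    * expR ((c (ord_next k) - c (ord_this k)) * (s - t))
    = bidiag_coord lam pi (T s) k.
  by move=> Js; rewrite (TS s Js) (bidiag_coord_flow lam_inj k (cT t Jt) (LS s)).
apply: near_eq_is_derive; first exact: (near_eq_open oJ Jt bE).
have h := is_derive_mul_expR (c (ord_next k) - c (ord_this k)) t
  (is_derive_cst (bidiag_coord lam pi (T t) k) t 1).
by apply: is_derive_eq h _; rewrite subrr mulr0 expR0 mulr1 add0r.
Qed.

(** The coordinates of [T] and those of the explicit flow started at [T t] solve
    the same scalar equations, and the chart is injective, so [T] is that flow. *)
Lemma coord_toda_solution (J : set R) (T : R -> 'M[R]_n) :
  open J -> is_interval J -> (forall t, J t -> chart_domain lam pi (T t)) ->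
  (forall t, J t -> forall k : 'I_n.-1,
    is_derive t 1 (fun s => bidiag_coord lam pi (T s) k)
      ((c (ord_next k) - c (ord_this k)) * bidiag_coord lam pi (T t) k)) ->
  toda_solution lam g J T.
Proof.
move=> oJ iJ cT dT t Jt; split; first by case: (cT t Jt).
have [S [sS S0 cS LS]] := toda_flow g lam_inj t (cT t Jt).
have ST s : J s -> S s = T s.
  move=> Js; apply: (bidiag_coord_inj lam_inj (cS s) (cT s Js)) => k.
  rewrite (bidiag_coord_flow lam_inj k (cT t Jt) (LS s)).
  by rewrite [RHS](linear_ode_unique iJ (fun s Js => dT s Js k) Jt Js).
apply: near_eq_is_derive; first exact: (near_eq_open oJ Jt ST).
by rewrite -S0; case: (sS t I).
Qed.

Lemma toda_solution_explicit (T : R -> 'M[R]_n) :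
  toda_solution lam g setT T -> chart_domain lam pi (T 0) ->
  forall t, chart_domain lam pi (T t) /\
    chart_L lam pi (T t) = exp_diag c t *m chart_L lam pi (T 0) *m exp_diag c (- t).
Proof.
move=> sT c0 t; have [S [sS S0 cS LS]] := toda_flow g lam_inj 0 c0.
have iT : is_interval [set: R] by [].
rewrite (toda_unique lam_inj iT sT sS I (esym S0) I); split=> //.
by rewrite LS subr0.
Qed.

End LinearSystem.

Theorem proposition5p1 (R : realType) (n : nat) (hn : (2 <= n)%N)
    (lam : 'I_n -> R)
    (lam_incr : forall i j : 'I_n, (i < j)%N -> lam i < lam j)
    (g : R -> R) (pi : 'S_n) :
  (forall (J : set R) (T : R -> 'M[R]_n),
      open J -> is_interval J ->
      (forall t, J t -> chart_domain lam pi (T t)) ->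
      toda_solution lam g J T <->
      (forall t, J t -> forall i : 'I_n.-1,
         is_derive t 1 (fun s => bidiag_coord lam pi (T s) i)
           ((g (lam (pi (ord_next i))) - g (lam (pi (ord_this i))))
            * bidiag_coord lam pi (T t) i))) /\
  (forall T : R -> 'M[R]_n,
      toda_solution lam g setT T ->
      chart_domain lam pi (T 0) ->
      (forall t, chart_domain lam pi (T t)) /\
      ((forall k : 'I_n.-1,
          g (lam (pi (ord_next k))) < g (lam (pi (ord_this k)))) ->
       [/\ forall k : 'I_n.-1,
             bidiag_coord lam pi (T t) k @[t --> +oo] --> 0,
           T t @[t --> +oo] --> diag_perm lam pi
         & forall k : 'I_n.-1,
             T t (ord_this k) (ord_next k)
               * expR ((g (lam (pi (ord_this k)))
                        - g (lam (pi (ord_next k)))) * t) @[t --> +oo]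
             --> bidiag_coord lam pi (T 0) k])).
Proof.
have lam_inj : injective lam.
  move=> i j e; case: (ltngtP i j) => [ij|ij|/val_inj//].
    by have := lam_incr i j ij; rewrite e ltxx.
  by have := lam_incr j i ij; rewrite e ltxx.
split=> [J T oJ iJ cT|T sT c0].
  split=> h; first exact: toda_solution_coord.
  exact: coord_toda_solution.
have E := toda_solution_explicit lam_inj sT c0.
have cT t : chart_domain lam pi (T t) by case: (E t).
split=> // g_decr.
pose c i := g (lam (pi i)).
have bE t k : bidiag_coord lam pi (T t) k =
    bidiag_coord lam pi (T 0) k * expR ((c (ord_next k) - c (ord_this k)) * t).
  by rewrite (bidiag_coord_flow lam_inj k c0 (E t).2).
have hL : chart_L lam pi (T t) @[t --> +oo] --> (1%:M : 'M[R]_n).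
  have -> : (fun t => chart_L lam pi (T t)) =
      (fun t => exp_diag c t *m chart_L lam pi (T 0) *m exp_diag c (- t)).
    by apply/funext => t; case: (E t).
  apply: exp_diag_conj_cvg1; first exact: ord_consecutive_decr.
  by have [U []] := chart_domain_LU lam_inj c0.
have [limT limk] := chart_L_cvg1 lam_inj cT hL.
split=> // k.
  have -> : (fun t => bidiag_coord lam pi (T t) k) = fun t =>
      expR ((c (ord_next k) - c (ord_this k)) * t) * bidiag_coord lam pi (T 0) k.
    by apply/funext => t; rewrite bE mulrC.
  by apply: expR_neg_cvg0; rewrite subr_lt0; exact: g_decr.
have [r r1 Tr] := limk k.
have -> : (fun t => T t (ord_this k) (ord_next k)
    * expR ((g (lam (pi (ord_this k))) - g (lam (pi (ord_next k)))) * t)) =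
    fun t => bidiag_coord lam pi (T 0) k * r t.
  apply/funext => t; rewrite Tr bE.
  rewrite -[X in _ = X]mul1r -expR0.
  have <- : (c (ord_next k) - c (ord_this k)) * t
      + (c (ord_this k) - c (ord_next k)) * t = 0 by ring.
  by rewrite expRD /c; ring.
by apply: (cvg_eq_lim (cvgM (cvg_cst (bidiag_coord lam pi (T 0) k)) r1)); rewrite mulr1.
Qed.
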